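(* For $n\in\mathbb{N}$, let $(\mu_n,\nu_n)\in\mathcal{P}(\mathcal{X})\times\mathcal{P}(\mathcal{Y})$ satisfy $\mathcal{C}(\mu_n,\nu_n)<\infty$ and let $(f_n,g_n)$ be corresponding potentials. Suppose that $$\sup_{n\in\mathbb{N}}\int f_n^+\,d\mu_n<\infty,\qquad \sup_{n\in\mathbb{N}}\int g_n^+\,d\nu_n<\infty,$$ and that $\mu_n\to\mu$ and $\nu_n\to\nu$ weakly, where $(\mu,\nu)\in\mathcal{P}(\mathcal{X})\times\mathcal{P}(\mathcal{Y})$. Suppose that $\mu\ll\mu_n$ and $\nu\ll\nu_n$ for all $n$, and that $$\limsup_{C\to\infty}\limsup_{n\to\infty}\mu\left(\frac{d\mu}{d\mu_n}\ge C\right)=0,\qquad \limsup_{C\to\infty}\limsup_{n\to\infty}\nu\left(\frac{d\nu}{d\nu_n}\ge C\right)=0.$$ Then ($\mathcal{C}(\mu,\nu)<\infty$ and) $f_n\oplus g_n\to f\oplus g$ in $\mu\otimes\nu$-probability, where $(f,g)$ are arbitrary potentials for $(\mu,\nu)$. If moreover $\alpha_n:=\int\arctan(f_n)\,d\mu_n$ converges to a limit $\alpha$ and $(f,g)$ are the potentials for $(\mu,\nu)$ with $\int\arctan(f)\,d\mu=\alpha$, then $f_n\to f$ in $\mu$-probability and $g_n\to g$ in $\nu$-probability.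
   Context: $\mathcal{X},\mathcal{Y}$ are Polish spaces with their Borel $\sigma$-fields; $\mathcal{P}(\mathcal{X}),\mathcal{P}(\mathcal{Y})$ are the sets of Borel probability measures; $c:\mathcal{X}\times\mathcal{Y}\to[0,\infty)$ is continuous. $\Pi(\mu,\nu)$ is the set of couplings, i.e. probability measures on $\mathcal{X}\times\mathcal{Y}$ with marginals $(\mu,\nu)$. The entropic optimal transport problem is $$\mathcal{C}(\mu,\nu):=\inf_{\pi\in\Pi(\mu,\nu)}\int c\,d\pi+H(\pi|\mu\otimes\nu),$$ where $H(\pi|\rho)=\int\log\frac{d\pi}{d\rho}\,d\pi$ if $\pi\ll\rho$ and $H(\pi|\rho)=\infty$ otherwise. If $\mathcal{C}(\mu,\nu)<\infty$, there is a unique minimizer $\pi_*\in\Pi(\mu,\nu)$, called the optimal coupling, and there are measurable functions $f:\mathcal{X}\to\mathbb{R}$, $g:\mathcal{Y}\to\mathbb{R}$, called potentials for $(\mu,\nu)$, such that $\frac{d\pi_*}{d(\mu\otimes\nu)}=e^{f\oplus g-c}$ $\mu\otimes\nu$-a.s., where $(f\oplus g)(x,y):=f(x)+g(y)$. Potentials are a.s. unique up to an additive constant ($(f+a,g-a)$, $a\in\mathbb{R}$); since $\arctan$ is strictly increasing, fixing $\int\arctan(f)\,d\mu$ determines the constant. $f^+=\max(f,0)$. *)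

(* Defs.v *)
From HB Require Import structures.
From mathcomp Require Import all_boot all_order all_algebra.
From mathcomp Require Import all_classical all_reals all_analysis.

Set Implicit Arguments.
Unset Strict Implicit.
Unset Printing Implicit Defensive.

Import Order.TTheory GRing.Theory Num.Theory.
Import numFieldNormedType.Exports.

Local Open Scope classical_set_scope.
Local Open Scope ring_scope.

(* Polishness is a property of the topology: some complete metric with values
   in [R] induces it, and there is a countable dense subset. *)
Definition polish (R : realType) (T : topologicalType) : Prop :=
  (exists d : T -> T -> R,
    [/\ (forall x y, 0 <= d x y) /\ (forall x y, d x y = 0 <-> x = y),
        forall x y, d x y = d y x,
        forall x y z, d x z <= d x y + d y z,
        forall (x : T) (A : set T),
          nbhs x A <-> exists2 e : R, 0 < e & [set y | d x y < e] `<=` A &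
        forall u : nat -> T,
          (forall e : R, 0 < e -> exists N : nat, forall m n : nat,
             (N <= m)%N -> (N <= n)%N -> d (u m) (u n) < e) ->
          exists x : T, u @ \oo --> x]) /\
  (exists2 D : set T, countable D & dense D).

(* [borel T] is a copy of [T]; its measurable sets are generated by the open
   sets. The type [borel X * borel Y] carries the product sigma-algebra, which
   is the Borel one of [X * Y] when [X] and [Y] are second countable, in
   particular when they are Polish. *)
Notation borel T := (g_sigma_algebraType (@open T)).

Definition density (d : measure_display) (T : measurableType d) (R : realType)
    (nu mu : probability T R) : T -> \bar R :=
  Radon_Nikodym (charge_of_finite_measure nu) mu.

Definition relative_entropy (d : measure_display) (T : measurableType d)
    (R : realType) (pi rho : probability T R) : \bar R :=
  if `[< pi `<< rho >] then (\int[pi]_x lne (density pi rho x))%E else +oo%E.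

Definition cvg_in_probability (d : measure_display) (T : measurableType d)
    (R : realType) (P : probability T R) (h_ : nat -> T -> R) (h : T -> R) :
    Prop :=
  forall e : R, 0 < e ->
    (fun n => P [set x | e < `|h_ n x - h x|]) @ \oo --> 0%E.

Definition weak_cvg (R : realType) (T : ptopologicalType)
    (P_ : nat -> probability (borel T) R) (P : probability (borel T) R) :
    Prop :=
  forall h : T -> R, continuous h -> bounded_fun h ->
    (fun n => \int[P_ n]_x h x) @ \oo --> \int[P]_x h x.

Definition oplus (R : realType) (X Y : Type) (f : X -> R) (g : Y -> R)
    (z : X * Y) : R := f z.1 + g z.2.

Section entropic_optimal_transport.
Variables (R : realType) (X Y : ptopologicalType) (c : X * Y -> R).
Implicit Types (mu : probability (borel X) R) (nu : probability (borel Y) R).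
Implicit Types pi : probability (borel X * borel Y)%type R.

Definition coupling mu nu : set (probability (borel X * borel Y)%type R) :=
  [set pi | (forall A : set (borel X), measurable A ->
               pushforward pi fst A = mu A) /\
            (forall B : set (borel Y), measurable B ->
               pushforward pi snd B = nu B)].

Definition transport_cost mu nu pi : \bar R :=
  (\int[pi]_z (c z)%:E + relative_entropy pi (mu \x nu))%E.

Definition eot_cost mu nu : \bar R :=
  ereal_inf [set transport_cost mu nu pi | pi in coupling mu nu].

Definition optimal_coupling mu nu pi : Prop :=
  [/\ (eot_cost mu nu < +oo)%E, coupling mu nu pi &
      transport_cost mu nu pi = eot_cost mu nu].

Definition potentials mu nu (f : X -> R) (g : Y -> R) : Prop :=
  [/\ measurable_fun [set: borel X] f,
      measurable_fun [set: borel Y] g &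
      exists pi, [/\ optimal_coupling mu nu pi,
        pi `<< (mu \x nu)%E &
        {ae (mu \x nu)%E, forall z,
           density pi (mu \x nu)%E z = (expR (oplus f g z - c z))%:E}]].

End entropic_optimal_transport.

(* Main.v *)
(* Work along an ultrafilter finer than [\oo], so that bounded real sequences
   converge.  A potential satisfies the Schrodinger equation
   [exp (- f_n x) = \int exp (g_n y - c (x, y)) d(nu_n y)].  The bound on [g_n^+]
   allows to truncate [g_n] at a level [M], up to an error [O(1/M)] in
   [mu_n]-probability, and approximating [exp (- c)] by sums of products
   [phi x * psi y] turns the truncated right-hand side into a combination of the
   [phi]'s whose coefficients converge along the ultrafilter.  So [f_n] is
   arbitrarily close, in [mu_n]-probability, to bounded continuous functions that
   do not depend on [n], which yields a limit [f]; likewise for [g_n].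
   Passing to the limit in integrals against continuous functions, [exp (f (+) g
   - c)] is the density of a coupling of [(mu, nu)] of finite cost, and such a
   coupling determines [f (+) g] a.e.  By the tail conditions, sets of small
   [mu_n]-probability have small [mu]-probability, hence [f_n] tends to [f] in
   [mu]-probability.  All ultrafilters give the same [f (+) g], and the same
   [f] once [\int atan f] is prescribed. *)

Require Import Defs.
From HB Require Import structures.
From mathcomp Require Import all_boot all_order all_algebra.
From mathcomp Require Import all_classical all_reals all_analysis.
From mathcomp Require Import measurable_realfun ring lra.
Import Order.TTheory GRing.Theory Num.Theory.
Import numFieldNormedType.Exports.

Set Implicit Arguments.
Unset Strict Implicit.
Unset Printing Implicit Defensive.

Local Open Scope classical_set_scope.
Local Open Scope ring_scope.

(** The obstacle is that [f_ n] is controlled only under [mu_ n], which varies with [n]; moreover no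
    lower bound on the potentials and no upper bound on [c] is given. Hence every integrand is first
    made bounded. The truncated distance [Num.min 1] of the absolute difference metrizes convergence
    in probability, and between two bounded continuous functions it is itself bounded and
    continuous. Weak convergence therefore carries the closeness of two approximants of [f_ n] from
    [mu_ n] to [mu], so that the approximants form a Cauchy sequence under [mu]. Capping the
    exponential of a potential at level [M] multiplies the density of the coupling by a factor in
    [0, 1]; the loss is a sum of two marginal tails, at most [2 * K / M] by Markov's inequality.
    This bound is uniform in [n], so the limit in [n] is taken first and [M] tends to infinity
    afterwards. In the absence of compactness, [exp (- c)] is approximated by tensors in mean and
    not uniformly, by squeezing it between two tensors. *)

Section ultrafilters.
Context {R : realType}.

(** Compactness of the segment gives a cluster point. For an ultrafilter a cluster point is a limit:
    otherwise the complement of the preimage of some neighbourhood would belong to [U]. *)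
Lemma ultra_bounded_cvg (U : set_system nat) (u : nat -> R) (M : R) :
  UltraFilter U -> (forall n, `|u n| <= M) -> exists l : R, u @ U --> l.
Proof.
move=> UU uM.
have [|l [_ lU]] := @segment_compact R (- M) M (u @ U) _.
  by apply: (@filterS _ U _ setT) filterT => n _ /=; rewrite in_itv/= -ler_norml.
exists l => B lB; have [//|UB] := in_ultra_setVsetC (u @^-1` B) UU.
by have [x [/= + Bx]] := lU _ _ (UB : (u @ U) (~` B)) lB.
Qed.

(** If the preimage of [B] is not in [F], removing it from the members of [F] leaves a base of a
    proper filter; an ultrafilter finer than that one contradicts the hypothesis. This reduces
    convergence along [\oo] to limits along single ultrafilters, which may be identified one at a
    time. *)
Lemma cvg_ultra (T : topologicalType) (F : set_system nat) (u : nat -> T)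
    (l : T) : Filter F ->
  (forall U, UltraFilter U -> F `<=` U -> u @ U --> l) -> u @ F --> l.
Proof.
move=> FF ul B lB; apply: contrapT => nFB.
pose G := filter_from F (fun A => A `\` (u @^-1` B)).
have GF : ProperFilter G.
  apply: filter_from_proper.
    apply: filter_from_filter; first by exists setT; exact: filterT.
    move=> C D FC FD; exists (C `&` D); first exact: filterI.
    by move=> x [[Cx Dx] nB].
  move=> A FA; apply: contrapT => /set0P/negP; rewrite negbK => /eqP A0.
  by move: A0; rewrite setD_eq0 => AB; apply: nFB; exact: (@filterS _ F _ A).
have [U [UU GU]] := ultraFilterLemma GF.
have FU : F `<=` U by move=> A FA; apply: GU; exists A => // x [].
have UB : U (u @^-1` B) := ul U UU FU B lB.
have UnB : U (~` (u @^-1` B)).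
  by apply: GU; exists setT; [exact: filterT|move=> x []].
by have [x []] := filter_ex (filterI UB UnB).
Qed.

Lemma cvg_norm_bound (F : set_system nat) (u : nat -> R) (l K : R) :
  ProperFilter F -> u @ F --> l ->
  (forall e, 0 < e -> \forall n \near F, `|u n| <= K + e) -> `|l| <= K.
Proof.
move=> FF ul uK; apply/ler_addgt0Pr => e e0.
have e20 : 0 < e / 2 by rewrite divr_gt0.
have /cvgrPdist_le/(_ _ e20) H := ul.
have [n [/= H1 H2]] := filter_ex (filterI H (uK _ e20)).
have := ler_normD (l - u n) (u n); rewrite subrK => /le_trans; apply.
by rewrite [e]splitr; lra.
Qed.

End ultrafilters.

(** * Integrals of bounded functions *)

Section bounded_measurable.
Context d (T : measurableType d) (R : realType).
Implicit Types (f g : T -> R) (P : probability T R).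

(** On this class the real-valued integral is linear and monotone for every probability at once, so
    no integrability has to be tracked while the measures vary. *)
Definition bmfun f := measurable_fun setT f /\ exists M : R, forall x, `|f x| <= M.

Lemma bmfun_cst (r : R) : bmfun (fun=> r).
Proof. by split; [exact: measurable_cst|exists `|r|]. Qed.

Lemma bmfunD f g : bmfun f -> bmfun g -> bmfun (fun x => f x + g x).
Proof.
move=> [mf [M fM]] [mg [N gN]]; split; first exact: measurable_funD.
by exists (M + N) => x; rewrite (le_trans (ler_normD _ _))// lerD.
Qed.

Lemma bmfunB f g : bmfun f -> bmfun g -> bmfun (fun x => f x - g x).
Proof.
move=> [mf [M fM]] [mg [N gN]]; split; first exact: measurable_funB.
by exists (M + N) => x; rewrite (le_trans (ler_normB _ _))// lerD.
Qed.

Lemma bmfunM f g : bmfun f -> bmfun g -> bmfun (fun x => f x * g x).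
Proof.
move=> [mf [M fM]] [mg [N gN]]; split; first exact: measurable_funM.
by exists (M * N) => x; rewrite normrM ler_pM.
Qed.

Lemma bmfun_norm f : bmfun f -> bmfun (fun x => `|f x|).
Proof.
move=> [mf [M fM]]; split; first exact: measurableT_comp.
by exists M => x; rewrite normr_id.
Qed.

Lemma bmfun_integrable P f : bmfun f -> P.-integrable setT (EFin \o f).
Proof.
move=> [mf [M fM]]; apply: measurable_bounded_integrable => //.
  by rewrite (le_lt_trans (probability_le1 P measurableT)) ?ltry.
exists M; split; first exact: num_real.
by move=> r /ltW Mr x _ /=; exact: le_trans (fM x) Mr.
Qed.

Lemma bmfun_integralE P f : bmfun f ->
  (\int[P]_x (f x)%:E = (\int[P]_x f x)%:E)%E.
Proof.
move=> bf; rewrite /Rintegral fineK//.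
exact: (integrable_fin_num measurableT (bmfun_integrable P bf)).
Qed.

Lemma bmfun_integralD P f g : bmfun f -> bmfun g ->
  \int[P]_x (f x + g x) = \int[P]_x f x + \int[P]_x g x.
Proof. by move=> bf bg; rewrite RintegralD//; exact: bmfun_integrable. Qed.

Lemma bmfun_integralB P f g : bmfun f -> bmfun g ->
  \int[P]_x (f x - g x) = \int[P]_x f x - \int[P]_x g x.
Proof. by move=> bf bg; rewrite RintegralB//; exact: bmfun_integrable. Qed.

Lemma bmfun_integralZl P f r : bmfun f ->
  \int[P]_x (r * f x) = r * \int[P]_x f x.
Proof. by move=> bf; rewrite RintegralZl//; exact: bmfun_integrable. Qed.

Lemma prob_integral_cst P (r : R) : \int[P]_x r = r.
Proof.
by rewrite Rintegral_cst// [X in fine X](probability_setT P) mulr1.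
Qed.

Lemma le_bmfun_integral P f g : bmfun f -> bmfun g ->
  (forall x, f x <= g x) -> \int[P]_x f x <= \int[P]_x g x.
Proof.
by move=> bf bg fg; apply: le_Rintegral => //; exact: bmfun_integrable.
Qed.

Lemma bmfun_integral_norm P f : bmfun f ->
  `|\int[P]_x f x| <= \int[P]_x `|f x|.
Proof. by move=> bf; apply: le_normr_Rintegral => //; exact: bmfun_integrable. Qed.

Lemma bmfun_integral_dist P f g h : bmfun f -> bmfun g -> bmfun h ->
  (forall x, `|f x - g x| <= h x) ->
  `|\int[P]_x f x - \int[P]_x g x| <= \int[P]_x h x.
Proof.
move=> bf bg bh fgh; rewrite -bmfun_integralB//.
apply: le_trans (bmfun_integral_norm _ _) _; first exact: bmfunB.
by apply: le_bmfun_integral => //; apply: bmfun_norm; exact: bmfunB.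
Qed.

Lemma bmfun_integral_le_cst P f M : bmfun f -> (forall x, f x <= M) ->
  \int[P]_x f x <= M.
Proof.
move=> bf fM; rewrite -[leRHS](prob_integral_cst P).
by apply: le_bmfun_integral => //; exact: bmfun_cst.
Qed.

Lemma bmfun_integral_norm_cst P f M : bmfun f -> (forall x, `|f x| <= M) ->
  `|\int[P]_x f x| <= M.
Proof.
move=> bf fM; apply: le_trans (bmfun_integral_norm _ bf) _.
by apply: bmfun_integral_le_cst => //; exact: bmfun_norm.
Qed.

Lemma ae_bmfun_dominated P (f_ : nat -> T -> R) f (M : R) :
  (forall n, measurable_fun setT (f_ n)) -> measurable_fun setT f ->
  (forall n x, `|f_ n x| <= M) ->
  {ae P, forall x, f_ ^~ x @ \oo --> f x} ->
  (fun n => \int[P]_x f_ n x) @ \oo --> \int[P]_x f x.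
Proof.
move=> mf_ mf fM f_f.
have [|||||intf _ H] := @dominated_convergence _ _ _ P setT measurableT
  (fun n x => (f_ n x)%:E) (fun x => (f x)%:E) (fun=> M%:E).
- by move=> n; exact/measurable_EFinP.
- exact/measurable_EFinP.
- by apply: filterS f_f => x H _; apply: cvg_EFin => //; exact: nearW.
- exact: bmfun_integrable (bmfun_cst M).
- by apply: nearW => x n _; rewrite lee_fin.
apply: fine_cvg; rewrite /Rintegral fineK//.
exact: (integrable_fin_num measurableT intf).
Qed.

End bounded_measurable.

Section continuous_bounded.
Context {R : realType} {T : topologicalType}.
Implicit Types f g : T -> R.

Definition cbfun f := continuous f /\ exists M : R, forall x, `|f x| <= M.

Lemma cbfun_cst (r : R) : cbfun (fun=> r).
Proof. by split; [move=> x; exact: cvg_cst|exists `|r|]. Qed.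

Lemma cbfunM f g : cbfun f -> cbfun g -> cbfun (fun x => f x * g x).
Proof.
move=> [cf [M fM]] [cg [N gN]]; split; first by move=> x; exact: cvgM (cf x) (cg x).
by exists (M * N) => x; rewrite normrM ler_pM.
Qed.

Lemma cbfunD f g : cbfun f -> cbfun g -> cbfun (fun x => f x + g x).
Proof.
move=> [cf [M fM]] [cg [N gN]]; split; first by move=> x; exact: cvgD (cf x) (cg x).
by exists (M + N) => x; rewrite (le_trans (ler_normD _ _))// lerD.
Qed.

Lemma cbfun_comp f (h : R -> R) : cbfun f -> continuous h -> cbfun (h \o f).
Proof.
move=> [cf [M fM]] ch; split.
  by move=> x; apply: continuous_comp; [exact: cf|exact: ch].
have [|K [_ hK]] := @compact_bounded R R (h @` `[- M, M]).
  by apply: continuous_compact; [exact: continuous_subspaceT|exact: segment_compact].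
exists (K + 1) => x; apply: (hK (K + 1)); first by rewrite ltrDl.
by exists (f x) => //=; rewrite in_itv/= -ler_norml.
Qed.

Lemma cbfun_bounded f : cbfun f -> bounded_fun f.
Proof.
move=> [_ [M fM]]; exists M; split; first exact: num_real.
by move=> r Mr x _; exact: le_trans (fM x) (ltW Mr).
Qed.

End continuous_bounded.

Section borel_functions.
Context {R : realType} {T : ptopologicalType}.
Implicit Types f : T -> R.

Lemma continuous_borel_measurable f : continuous f ->
  measurable_fun [set: borel T] f.
Proof.
move=> cf; apply: (measurability _ (RGenOInfty.measurableE R)) => //.
move=> _ [_ [a ->] <-]; rewrite setTI; apply: sub_sigma_algebra.
by apply: open_comp => //; exact: interval_open.
Qed.

Lemma cbfun_bmfun f : cbfun f -> bmfun (f : borel T -> R).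
Proof. by move=> [cf bf]; split => //; exact: continuous_borel_measurable. Qed.

End borel_functions.

(** * Approximation by tensors *)

Section bump_base.
Context {R : realType} {T : ptopologicalType}.

(** The functions are [max 0 (r - d x a)], with [a] in a countable dense set and [r] the inverse of
    a positive integer: continuous, and positive exactly on the open ball. They stand for a
    countable base while remaining usable as factors of tensors. *)
Lemma polish_bump_base : polish R T -> exists b : nat -> T -> R,
  [/\ forall n, continuous (b n), forall n x, 0 <= b n x &
      forall x A, nbhs x A ->
        exists2 n, 0 < b n x & forall y, 0 < b n y -> A y].
Proof.
move=> [[d [[d0 dE] dC dD dN _]] [D cD dD']].
have [x0 Dx0] : exists x, D x.
  have [x []] := dD' setT (ex_intro _ point I) openT.
  by exists x.
(* An enumeration of [D]: an injection into [nat] is inverted, and numbers outside its range are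
   sent to [x0]. *)
have [e eD] : exists e : nat -> T, forall x, D x -> exists n, e n = x.
  have /countable_injP[f fI] := cD.
  exists (fun n => xget x0 [set x | D x /\ f x = n]) => x Dx.
  exists (f x); case: xgetP => [y _ [Dy fxy]|/(_ x)[]//].
  by apply: fI; rewrite ?inE.
pose b (n : nat) (x : T) : R :=
  if @unpickle (nat * nat)%type n is Some (i, j)
  then Num.max 0 (j.+1%:R^-1 - d x (e i)) else 0.
exists b; split.
- move=> n x; rewrite /b; case: unpickle => [[i j]|]; last exact: cvg_cst.
  apply: (@continuous_max _ _ (fun=> 0) (fun x => j.+1%:R^-1 - d x (e i))).
    exact: cvg_cst.
  apply: cvgB; first exact: cvg_cst.
  apply/cvgrPdist_lt => r r0; apply/dN; exists r => // y /= dxy.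
  have := dD x y (e i); have := dD y x (e i); rewrite (dC y x) => H1 H2.
  by rewrite ltr_norml; lra.
- by move=> n x; rewrite /b; case: unpickle => [[i j]|//]; rewrite le_max lexx.
move=> x A /dN[r r0 rA].
(* With radius below [r / 2], a ball whose centre is that close to [x] contains [x] and stays within
   distance [r] of it. *)
have [j jr] : exists j : nat, j.+1%:R^-1 < r / 2 :> R.
  have /ltr_add_invr[j] : 0 < r / 2 by rewrite divr_gt0.
  by rewrite add0r; exists j.
have j0 : 0 < j.+1%:R^-1 :> R by rewrite invr_gt0.
have [y [/= xy Dy]] : [set y | d x y < j.+1%:R^-1] `&` D !=set0.
  have : (interior [set y | d x y < j.+1%:R^-1]) `&` D !=set0.
    apply: dD'; last exact: open_interior.
    by exists x; apply/dN; exists j.+1%:R^-1.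
  by move=> [y [/interior_subset xy Dy]]; exists y.
have [i ei] := eD y Dy.
exists (pickle (i, j)); first by rewrite /b pickleK lt_max subr_gt0 ei xy orbT.
move=> z; rewrite /b pickleK lt_max ltxx/= subr_gt0 ei => zy.
apply: rA => /=; apply: le_lt_trans (dD x y z) _; rewrite (dC y z).
by rewrite [r]splitr ltrD// (lt_trans _ jr).
Qed.

End bump_base.

Section tensor.
Context {R : realType} {X Y : topologicalType}.

(** The algebra spanned by products of one-variable functions, given inductively so that limits and
    identities are proved by Fubini on products and linearity on sums. *)
Inductive tensor : (X * Y -> R) -> Prop :=
| tensor_prod f g : cbfun f -> cbfun g -> tensor (fun z => f z.1 * g z.2)
| tensor_add S T : tensor S -> tensor T -> tensor (fun z => S z + T z).

Lemma tensor_eq S T : S =1 T -> tensor S -> tensor T.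
Proof. by move=> /funext ->. Qed.

Lemma tensor_cst r : tensor (fun=> r).
Proof.
apply: (@tensor_eq (fun z => r * 1)); first by move=> z; rewrite mulr1.
exact: (@tensor_prod (fun=> r) (fun=> 1) (cbfun_cst _) (cbfun_cst _)).
Qed.

Lemma tensor_mul S T : tensor S -> tensor T -> tensor (fun z => S z * T z).
Proof.
move=> tS; elim=> [f g bf bg|T1 T2 _ ST1 _ ST2]; last first.
  by apply: tensor_eq (tensor_add ST1 ST2) => z; rewrite mulrDr.
elim: tS => [f' g' bf' bg'|S1 S2 _ ST1 _ ST2]; last first.
  by apply: tensor_eq (tensor_add ST1 ST2) => z; rewrite mulrDl.
apply: tensor_eq (tensor_prod (cbfunM bf' bf) (cbfunM bg' bg)) => z.
by rewrite mulrACA.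
Qed.

Lemma tensor_scale r T : tensor T -> tensor (fun z => r * T z).
Proof. exact: (tensor_mul (tensor_cst r)). Qed.

Lemma tensor_sum (I : Type) (s : seq I) (T : I -> X * Y -> R) :
  (forall i, tensor (T i)) -> tensor (fun z => \sum_(i <- s) T i z).
Proof.
move=> tT; elim: s => [|i s IH].
  by apply: tensor_eq (tensor_cst 0) => z; rewrite big_nil.
by apply: tensor_eq (tensor_add (tT i) IH) => z; rewrite big_cons.
Qed.

Lemma tensor_prodn (I : Type) (s : seq I) (T : I -> X * Y -> R) :
  (forall i, tensor (T i)) -> tensor (fun z => \prod_(i <- s) T i z).
Proof.
move=> tT; elim: s => [|i s IH].
  by apply: tensor_eq (tensor_cst 1) => z; rewrite big_nil.
by apply: tensor_eq (tensor_mul (tT i) IH) => z; rewrite big_cons.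
Qed.

End tensor.

Lemma tensor_bmfun {R : realType} {X Y : ptopologicalType} (T : X * Y -> R) :
  tensor T -> bmfun (T : (borel X * borel Y)%type -> R).
Proof.
elim=> [f g /cbfun_bmfun bf /cbfun_bmfun bg|S S' _ bS _ bS'];
  last exact: bmfunD.
apply: bmfunM.
- case: bf => mf [M fM]; split; last by exists M.
  exact: (measurableT_comp mf measurable_fst).
- case: bg => mg [M gM]; split; last by exists M.
  exact: (measurableT_comp mg measurable_snd).
Qed.

(** The sum counts the integers from 1 to [N] lying strictly below [a]. The last clause is what the
    induction consumes when the new integer is also below [a]. *)
Lemma sum_ltn_nat_real {R : realType} (N : nat) (a : R) :
  let S := \sum_(s < N) (s.+1%:R < a)%R%:R : R in
  [/\ S <= Num.max 0 a, a <= N%:R -> a - 1 <= S & N%:R < a -> S = N%:R].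
Proof.
elim: N => [|N [IH1 IH2 IH3]] /=.
  rewrite big_ord0; split => //; first by rewrite le_max lexx.
  by move=> a0; rewrite (le_trans _ (lexx 0))// subr_le0 (le_trans a0).
rewrite big_ord_recr/=; have [Na|aN] := ltP N.+1%:R a.
  have NSN : N%:R < N.+1%:R :> R by rewrite ltr_nat.
  rewrite (IH3 (lt_trans NSN Na)) mulr1n -natr1; split => //.
  by rewrite natr1 le_max (ltW Na) orbT.
rewrite mulr0n addr0; split => //.
move=> _; have [/IH2//|Na] := leP a N%:R.
by rewrite (IH3 Na) lerBlDr natr1.
Qed.

Section product_topology.
Context {R : realType} {X Y : ptopologicalType}.
Hypotheses (polishX : polish R X) (polishY : polish R Y).

Lemma open_rectangles (W : set (X * Y)) : open W ->
  exists u : nat -> X -> R, exists v : nat -> Y -> R,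
  [/\ forall l, continuous (u l), forall l, continuous (v l),
      forall l x, 0 <= u l x, forall l y, 0 <= v l y &
      forall z, W z <-> exists l, 0 < u l z.1 /\ 0 < v l z.2].
Proof.
move=> oW; have [bX [cX X0 bXP]] := polish_bump_base polishX.
have [bY [cY Y0 bYP]] := polish_bump_base polishY.
(* Pairs of balls whose product is not inside [W] are discarded by making the first factor zero, as
   are the integers that code no pair. *)
pose u l := if @unpickle (nat * nat)%type l is Some (i, j) then
  if `[< forall z, 0 < bX i z.1 -> 0 < bY j z.2 -> W z >] then bX i
  else fun=> 0 else fun=> 0.
pose v l := if @unpickle (nat * nat)%type l is Some (i, j) then bY j
  else fun=> 0.
exists u, v; split.
- move=> l; rewrite /u; case: unpickle => [[i j]|]; last by move=> ?; exact: cvg_cst.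
  by case: asbool => //; move=> ?; exact: cvg_cst.
- move=> l; rewrite /v; case: unpickle => [[i j]|]; first exact: cY.
  by move=> ?; exact: cvg_cst.
- by move=> l x; rewrite /u; case: unpickle => [[i j]|//]; case: asbool.
- by move=> l x; rewrite /v; case: unpickle => [[i j]|//].
move=> z; split=> [Wz|[l]]; last first.
  rewrite /u /v; case: unpickle => [[i j]|[]]; last by rewrite ltxx.
  by case: asboolP => [H []|_ []]; [exact: H|rewrite ltxx].
have [[A B] [/= Az Bz] AB] : nbhs z W by exact: open_nbhs_nbhs.
have [i iz iA] := bXP _ _ Az; have [j jz jB] := bYP _ _ Bz.
exists (pickle (i, j)); rewrite /u /v pickleK; case: asboolP => // -[] z' iz' jz'.
by apply: AB; split; [exact: iA|exact: jB].
Qed.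

(** Countability of the family of rectangles is what places their union in the product
    sigma-algebra. *)
Lemma open_prod_measurable (W : set (X * Y)) : open W ->
  measurable (W : set (borel X * borel Y)).
Proof.
move=> /open_rectangles[u [v [cu cv _ _ WE]]].
rewrite (_ : W = \bigcup_l (u l @^-1` `]0, +oo[ `*` v l @^-1` `]0, +oo[)).
  apply: bigcup_measurable => l _; apply: measurableX;
    rewrite -[X in measurable X]setTI;
    apply: continuous_borel_measurable => //; exact: measurable_itv.
apply/seteqP; split=> z.
  by move=> /WE[l [ul vl]]; exists l => //; split; rewrite /= in_itv/= andbT.
by move=> [l _ []] /=; rewrite !in_itv/= !andbT => ul vl; apply/WE; exists l.
Qed.

Lemma continuous_prod_measurable (f : X * Y -> R) : continuous f ->
  measurable_fun [set: (borel X * borel Y)%type] f.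
Proof.
move=> cf; apply: (measurability _ (RGenOInfty.measurableE R)) => //.
move=> _ [_ [a ->] <-]; rewrite setTI; apply: open_prod_measurable.
by apply: open_comp => //; exact: interval_open.
Qed.

Lemma open_tensor_approx (W : set (X * Y)) : open W ->
  exists t : nat -> X * Y -> R, [/\ forall k, tensor (t k),
    forall k z, 0 <= t k z <= \1_W z &
    forall z, t ^~ z @ \oo --> (\1_W z : R)].
Proof.
move=> /open_rectangles[u [v [cu cv u0 v0 WE]]].
(* [t k] is a soft union of the first [k] rectangles, one minus the product of the complements. It
   stays in [0, 1] and vanishes off [W]. At a point of the [l]-th rectangle it equals 1 as soon as
   [k] exceeds [l] and both cut-offs have reached 1, so the convergence is eventually constant. *)
pose cut (k : nat) (r : R) := Num.min 1 (k%:R * r).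
have cut0 k : cut k 0 = 0 by rewrite /cut mulr0 min_r.
have cut01 k r : 0 <= r -> 0 <= cut k r <= 1.
  by move=> r0; rewrite /cut le_min ler01 mulr_ge0// ge_min lexx.
have ccut (T : topologicalType) (f : T -> R) k : (forall x, 0 <= f x) ->
    continuous f -> cbfun (fun x => cut k (f x)).
  move=> f0 cf; split; last first.
    exists 1 => x; have /andP[? ?] := cut01 k _ (f0 x).
    by rewrite ger0_norm.
  move=> x; apply: (@continuous_min _ _ (fun=> 1) (fun x => k%:R * f x)).
    exact: cvg_cst.
  by apply: cvgM; [exact: cvg_cst|exact: cf].
pose q k z l := 1 - cut k (u l z.1) * cut k (v l z.2).
pose t k z : R := 1 - \prod_(l < k) q k z l.
have q01 k z l : 0 <= q k z l <= 1.
  have /andP[? ?] := cut01 k _ (u0 l z.1).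
  have /andP[? ?] := cut01 k _ (v0 l z.2).
  by rewrite /q subr_ge0 lerBlDr lerDl mulr_ge0// andbT mulr_ile1.
exists t.
have t1 z k l : (l < k)%N -> 1 <= k%:R * u l z.1 -> 1 <= k%:R * v l z.2 ->
    t k z = 1.
  move=> lk uk vk; rewrite /t (bigD1 (Ordinal lk))//= /q /cut !min_l//.
  by rewrite mulr1 subrr mul0r subr0.
have t0 z k : ~ W z -> t k z = 0.
  move=> nW; rewrite /t big1 ?subrr// => l _; rewrite /q.
  have [ul|] := ltP 0 (u l z.1); last first.
    by move=> ul; rewrite (@le_anti _ _ (u l z.1) 0) ?ul ?u0// cut0 mul0r subr0.
  have [vl|] := ltP 0 (v l z.2); last first.
    by move=> vl; rewrite (@le_anti _ _ (v l z.2) 0) ?vl ?v0// cut0 mulr0 subr0.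
  by exfalso; apply: nW; apply/WE; exists l.
have t01 k z : 0 <= t k z <= 1.
  have : 0 <= \prod_(l < k) q k z l <= 1.
    elim/big_ind: _ => [|a b /andP[a0 a1] /andP[b0 b1]|l _ //].
      by rewrite ler01 lexx.
    by rewrite mulr_ge0// mulr_ile1.
  by rewrite /t => /andP[? ?]; rewrite subr_ge0 lerBlDr lerDl; apply/andP.
split.
- move=> k; apply: tensor_eq (tensor_add (tensor_cst 1)
    (tensor_scale (-1) (tensor_prodn (T := fun (l : 'I_k) z => q k z l) _ _))).
    by move=> z /=; rewrite mulN1r /t.
  move=> l; apply: tensor_eq (tensor_add (tensor_cst 1)
    (tensor_scale (-1) (tensor_prod (ccut _ _ k (u0 l) (cu l))
                                    (ccut _ _ k (v0 l) (cv l))))).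
  by move=> z /=; rewrite mulN1r /q.
- move=> k z; rewrite indicE; have [/set_mem//|/negP nW] := boolP (z \in W).
  by rewrite t0 ?lexx// => Wz; apply: nW; rewrite inE.
move=> z; rewrite indicE; have [/set_mem/WE[l [ul vl]]|/negP nW] := boolP (z \in W).
  apply: cvg_near_cst; near=> k; apply: (t1 z k l).
  - by near: k; exists l.+1.
  - rewrite -ler_pdivrMr// mul1r; near: k; exact: nbhs_infty_ger.
  - rewrite -ler_pdivrMr// mul1r; near: k; exact: nbhs_infty_ger.
apply: cvg_near_cst; apply: nearW => k; apply: t0 => Wz.
by apply: nW; rewrite inE.
Unshelve. all: by end_near.
Qed.

Section sandwich.
Variable P : probability (borel X * borel Y)%type R.

(* Layer cake: [f] is within [1/N] of the average of the indicators of the open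
   sets [f > s/N], which are limits of tensors from below. *)
Lemma tensor_lower (f : X * Y -> R) (eta : R) : continuous f ->
  (forall z, 0 <= f z <= 1) -> 0 < eta ->
  exists T, [/\ tensor T, forall z, T z <= f z &
    \int[P]_z f z - \int[P]_z T z <= eta].
Proof.
move=> cf f01 eta0.
have /ltr_add_invr[N] : 0 < eta / 2 by rewrite divr_gt0.
(* [N.+1] levels, with the inverse of [N.+1] below [eta / 2]: one half of [eta] pays for the
   discretization into levels, the other for replacing indicators by tensors. *)
rewrite add0r => Neta; pose N1 : R := N.+1%:R; have N10 : 0 < N1 by rewrite ltr0n.
pose W s := [set z | s.+1%:R < N1 * f z].
have oW s : open (W s).
  have -> : W s = f @^-1` `]s.+1%:R / N1, +oo[.
    apply/seteqP; split=> z /=; rewrite in_itv/= andbT ltr_pdivrMr// mulrC//.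
  by apply: open_comp => //; exact: interval_open.
have [t tP] := choice (fun s => open_tensor_approx (oW s)).
have tT s k : tensor (t s k) by have [] := tP s.
have t01 s k z : 0 <= t s k z <= \1_(W s) z by have [_ +] := tP s; exact.
have tcvg s z : t s ^~ z @ \oo --> (\1_(W s) z : R).
  by have [_ _ +] := tP s; exact.
pose T k z := N1^-1 * \sum_(s < N.+1) t s k z.
pose g z : R := N1^-1 * \sum_(s < N.+1) \1_(W s) z.
have gE z : g z = N1^-1 * \sum_(s < N.+1) (s.+1%:R < N1 * f z)%R%:R.
  congr (_ * _); apply: eq_bigr => s _; rewrite indicE; congr ((_ : bool)%:R).
  by apply/idP/idP; [move/set_mem|move=> ?; exact/mem_set].
have gf z : f z - N1^-1 <= g z <= f z.
  have /andP[fz0 fz1] := f01 z.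
  have [+ + _] := sum_ltn_nat_real N.+1 (N1 * f z).
  rewrite gE ![N1^-1 * _]mulrC ler_pdivlMr// ler_pdivrMr//.
  rewrite mulrBl mulVf ?gt_eqF// (max_r (mulr_ge0 (ltW N10) fz0)) ![f z * _]mulrC.
  by move=> -> -> //; rewrite ler_piMr// ltW.
have Tg k z : 0 <= T k z <= g z.
  rewrite /T /g ler_pM2l ?invr_gt0// mulr_ge0 ?invr_ge0 ?(ltW N10)//=.
    by apply: ler_sum => s _; have /andP[] := t01 s k z.
  by apply: sumr_ge0 => s _; have /andP[] := t01 s k z.
have TT k : tensor (T k) by apply: tensor_scale; apply: tensor_sum => s.
have mg : measurable_fun [set: (borel X * borel Y)%type] g.
  apply: measurable_funM; first exact: measurable_cst.
  apply: measurable_sum => s.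
  by apply: measurable_indic; exact: open_prod_measurable.
have g1 z : `|g z| <= 1.
  have /andP[T0 T1] := Tg 0%N z; have /andP[_ gz] := gf z.
  rewrite ger0_norm ?(le_trans T0 T1)//.
  by rewrite (le_trans gz)//; have /andP[] := f01 z.
have bg : bmfun (g : (borel X * borel Y)%type -> R) by split => //; exists 1.
have bf : bmfun (f : (borel X * borel Y)%type -> R).
  split; first exact: continuous_prod_measurable.
  by exists 1 => z; have /andP[? ?] := f01 z; rewrite ger0_norm.
have Tcvg : (fun k => \int[P]_z T k z) @ \oo --> \int[P]_z g z.
  apply: (@ae_bmfun_dominated _ _ _ _ _ _ 1) => //.
  - by move=> k; have [] := tensor_bmfun (TT k).
  - move=> k z; have /andP[Tz0 Tz] := Tg k z; rewrite ger0_norm//.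
    by rewrite (le_trans Tz)// (le_trans (ler_norm _)).
  - apply: aeW => z; apply: cvgM; first exact: cvg_cst.
    elim: N.+1 => [|m IH].
      by rewrite big_ord0; under eq_fun do rewrite big_ord0; exact: cvg_cst.
    rewrite big_ord_recr; under eq_fun do rewrite big_ord_recr.
    by apply: cvgD IH _; exact: tcvg.
have /cvgrPdist_le/(_ (eta / 2))[|k _ /(_ _ (leqnn k))/= Hk] := Tcvg.
  by rewrite divr_gt0.
exists (T k); split => // [z|].
  by have /andP[_ H1] := Tg k z; have /andP[_ H2] := gf z; exact: le_trans H2.
have : \int[P]_z f z - N1^-1 <= \int[P]_z g z.
  rewrite -(prob_integral_cst P N1^-1) -bmfun_integralB//; last exact: bmfun_cst.
  apply: le_bmfun_integral => //; first by apply: bmfunB => //; exact: bmfun_cst.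
  by move=> z; have /andP[] := gf z.
move: Hk; rewrite ler_norml => /andP[_].
move: Neta; rewrite -/N1; set a := N1^-1; lra.
Qed.

(** The upper tensor is one minus a lower tensor of [1 - f]. With bounds on both sides, the error is
    dominated by the tensor [T' - T], whose integral can be followed along weakly converging
    measures. *)
Lemma tensor_sandwich (f : X * Y -> R) (eta : R) : continuous f ->
  (forall z, 0 <= f z <= 1) -> 0 < eta ->
  exists T T', [/\ tensor T, tensor T', forall z, T z <= f z <= T' z &
    \int[P]_z (T' z - T z) <= eta].
Proof.
move=> cf f01 eta0; have eta20 : 0 < eta / 2 by rewrite divr_gt0.
have [T [tT Tf intT]] := tensor_lower cf f01 eta20.
have [||S [tS Sf intS]] := @tensor_lower (fun z => 1 - f z) (eta / 2) _ _ eta20.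
- by move=> z; apply: cvgB; [exact: cvg_cst|exact: cf].
- by move=> z; rewrite subr_ge0 lerBlDr lerDl andbC; exact: f01.
have bf : bmfun (f : (borel X * borel Y)%type -> R).
  split; first exact: continuous_prod_measurable.
  by exists 1 => z; have /andP[? ?] := f01 z; rewrite ger0_norm.
have bT := tensor_bmfun tT; have bS := tensor_bmfun tS.
exists T, (fun z => 1 + -1 * S z); split => //.
- exact: tensor_add (tensor_cst 1) (tensor_scale _ tS).
- by move=> z; rewrite Tf/=; have := Sf z; lra.
have b1 := @bmfun_cst _ (borel X * borel Y)%type R 1.
rewrite (_ : (fun z => _) = (fun z => (1 - S z) - T z)); last first.
  by apply/funext => z; ring.
rewrite !bmfun_integralB ?prob_integral_cst//; last exact: bmfunB.
by move: intS; rewrite bmfun_integralB// prob_integral_cst; lra.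
Qed.

End sandwich.
End product_topology.

(** * Integrals against product measures *)

Section product_integrals.
Context d1 d2 (T1 : measurableType d1) (T2 : measurableType d2) (R : realType).
Variables (P : probability T1 R) (Q : probability T2 R).

Lemma bmfun_fst (f : T1 -> R) : bmfun f -> bmfun (fun z : T1 * T2 => f z.1).
Proof.
move=> [mf [M fM]]; split; last by exists M.
exact: (measurableT_comp mf measurable_fst).
Qed.

Lemma bmfun_snd (g : T2 -> R) : bmfun g -> bmfun (fun z : T1 * T2 => g z.2).
Proof.
move=> [mg [M gM]]; split; last by exists M.
exact: (measurableT_comp mg measurable_snd).
Qed.

Lemma integral_prod_tensor (f : T1 -> R) (g : T2 -> R) : bmfun f -> bmfun g ->
  \int[(P \x Q)%E]_z (f z.1 * g z.2) = \int[P]_x f x * \int[Q]_y g y.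
Proof.
move=> bf bg.
have bfg : bmfun (fun z : T1 * T2 => f z.1 * g z.2).
  by apply: bmfunM; [exact: bmfun_fst|exact: bmfun_snd].
rewrite {1}/Rintegral -(integral12_prod_meas1 (bmfun_integrable _ bfg)).
have -> : (\int[P]_x \int[Q]_y (f x * g y)%:E =
    \int[P]_x (\int[Q]_y g y * f x)%:E)%E.
  apply: eq_integral => x _; rewrite mulrC -bmfun_integralZl//.
  rewrite -bmfun_integralE//.
  by apply: bmfunM => //; exact: bmfun_cst.
rewrite -[fine _]/(\int[P]_x (\int[Q]_y g y * f x)).
by rewrite bmfun_integralZl// mulrC.
Qed.

Lemma integral_prod_swap (f : T1 * T2 -> R) : bmfun f ->
  \int[(Q \x P)%E]_z f (z.2, z.1) = \int[(P \x Q)%E]_z f z.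
Proof.
move=> bf; have bf' : bmfun (fun z : T2 * T1 => f (z.2, z.1)).
  case: bf => mf [M fM]; split; last by exists M.
  apply: (measurableT_comp mf).
  by apply: measurable_fun_pair; [exact: measurable_snd|exact: measurable_fst].
rewrite /Rintegral -(integral21_prod_meas1 (bmfun_integrable _ bf)).
by rewrite -(integral12_prod_meas1 (bmfun_integrable _ bf')).
Qed.

End product_integrals.

(** * Weak convergence of products along an ultrafilter *)

Definition wcvg_along {R : realType} {T : ptopologicalType}
    (U : set_system nat) (P_ : nat -> probability (borel T) R)
    (P : probability (borel T) R) :=
  forall h : T -> R, cbfun h ->
    (fun n => \int[P_ n]_x h x) @ U --> \int[P]_x h x.

Lemma weak_cvg_along {R : realType} {T : ptopologicalType}
    (U : set_system nat) (P_ : nat -> probability (borel T) R)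
    (P : probability (borel T) R) :
  \oo `<=` U -> weak_cvg P_ P -> wcvg_along U P_ P.
Proof.
move=> ooU PP h bh A /(PP h bh.1 (cbfun_bounded bh)); exact: ooU.
Qed.

Section weak_limits.
Context {R : realType} {X Y : ptopologicalType}.
Hypotheses (polishX : polish R X) (polishY : polish R Y).
Variable (U : set_system nat).
Hypothesis (UU : UltraFilter U).
Variables (mu_ : nat -> probability (borel X) R) (mu : probability (borel X) R).
Variables (nu_ : nat -> probability (borel Y) R) (nu : probability (borel Y) R).
Hypotheses (mu_cvg : wcvg_along U mu_ mu) (nu_cvg : wcvg_along U nu_ nu).

Lemma tensor_weak_cvg (T : X * Y -> R) : tensor T ->
  (fun n => \int[(mu_ n \x nu_ n)%E]_z T z) @ U --> \int[(mu \x nu)%E]_z T z.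
Proof.
elim=> [f g bf bg|S S' tS IH tS' IH'].
  have bf' := cbfun_bmfun bf; have bg' := cbfun_bmfun bg.
  rewrite integral_prod_tensor//.
  under eq_fun do rewrite integral_prod_tensor//.
  by apply: cvgM; [exact: mu_cvg|exact: nu_cvg].
have bS := tensor_bmfun tS; have bS' := tensor_bmfun tS'.
rewrite bmfun_integralD//; under eq_fun do rewrite bmfun_integralD//.
exact: cvgD.
Qed.

(** The error is at most [S - T], a tensor with small integral under the limit product. That
    integral converges along [U], so the same [T] works for the moving products. *)
Lemma continuous_tensor_approx (f : X * Y -> R) (eta : R) : continuous f ->
  (forall z, 0 <= f z <= 1) -> 0 < eta ->
  exists2 T : X * Y -> R, tensor T & \int[(mu \x nu)%E]_z `|f z - T z| <= eta /\
    \forall n \near U, \int[(mu_ n \x nu_ n)%E]_z `|f z - T z| <= eta.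
Proof.
move=> cf f01 eta0; have eta20 : 0 < eta / 2 by rewrite divr_gt0.
have [T [S [tT tS TfS intST]]] :=
  tensor_sandwich polishX polishY (mu \x nu)%E cf f01 eta20.
have bf : bmfun (f : (borel X * borel Y)%type -> R).
  split; first exact: continuous_prod_measurable.
  by exists 1 => z; have /andP[? ?] := f01 z; rewrite ger0_norm.
have bT := tensor_bmfun tT; have bS := tensor_bmfun tS.
have tST : tensor (fun z => S z - T z).
  by apply: tensor_eq (tensor_add tS (tensor_scale (-1) tT)) => z; rewrite mulN1r.
have le (P : probability (borel X * borel Y)%type R) :
    \int[P]_z `|f z - T z| <= \int[P]_z (S z - T z).
  apply: le_bmfun_integral; [exact/bmfun_norm/bmfunB|exact: bmfunB|].
  by move=> z; have /andP[? ?] := TfS z; rewrite ger0_norm ?subr_ge0// lerB.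
exists T => //; split.
  by rewrite (le_trans (le _))// (le_trans intST)// ler_pdivrMr// ler_peMr ?ler1n ?ltW.
have /cvgrPdist_le/(_ _ eta20) := tensor_weak_cvg tST.
apply: filterS => n; rewrite ler_norml => /andP[+ _] => H.
by apply: le_trans (le _) _; lra.
Qed.

(** For a single product, integrating out [y] leaves [f] times the integral of [w_ n * g] under
    [nu_ n], a bounded real sequence. Nothing relates the weights for different [n], so its limit
    exists only thanks to the ultrafilter. The estimate is uniform in [a], which may then depend on
    [n]. *)
Lemma tensor_weight (w_ : nat -> Y -> R) (M L : R) (T : X * Y -> R) :
  (forall n, bmfun (w_ n : borel Y -> R)) -> (forall n y, `|w_ n y| <= M) ->
  0 < L -> tensor T ->
  exists2 B : X -> R, cbfun B & forall eta : R, 0 < eta ->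
    \forall n \near U, forall a : borel X -> R,
    bmfun a -> (forall x, `|a x| <= L) ->
    `|\int[(mu_ n \x nu_ n)%E]_z (a z.1 * w_ n z.2 * T z)
      - \int[mu_ n]_x (a x * B x)| <= eta.
Proof.
move=> bw wM L0; elim=> [f g bf bg|S1 S2 tS1 [B1 bB1 IH1] tS2 [B2 bB2 IH2]].
  have bg' := cbfun_bmfun bg; have bf' := cbfun_bmfun bf.
  have [bf0 [K fK]] := bf; have [_ [N gN]] := bg.
  have bwg n : bmfun (fun y : borel Y => w_ n y * g y) by exact: bmfunM.
  have [b bcvg] : exists b : R, (fun n => \int[nu_ n]_y (w_ n y * g y)) @ U --> b.
    apply: (@ultra_bounded_cvg _ _ _ (M * N)) => n.
    by apply: bmfun_integral_norm_cst => // y; rewrite normrM ler_pM.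
  exists (fun x => b * f x); first exact: cbfunM (cbfun_cst b) bf.
  pose K1 := L * (`|K| + 1).
  have K10 : 0 < K1 by rewrite mulr_gt0// ltr_wpDl.
  move=> eta eta0; have /cvgrPdist_le/(_ (eta / K1)) := bcvg.
  rewrite divr_gt0// => /(_ isT); apply: filterS => n nb a ba aL.
  have baf : bmfun (fun x : borel X => a x * f x) by exact: bmfunM.
  under eq_Rintegral do rewrite mulrACA.
  rewrite (integral_prod_tensor _ _ baf (bwg n)).
  under [X in _ - X]eq_Rintegral do rewrite mulrCA.
  rewrite bmfun_integralZl// mulrC -mulrBl normrM distrC.
  rewrite -[leRHS](@divfK _ K1) ?gt_eqF// ler_pM//.
  apply: bmfun_integral_norm_cst => // x; rewrite normrM.
  rewrite ler_pM// (le_trans (fK x))//.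
  by rewrite (le_trans (ler_norm K))// lerDl.
exists (fun x => B1 x + B2 x); first exact: cbfunD.
move=> eta eta0; have eta20 : 0 < eta / 2 by rewrite divr_gt0.
apply: filterS2 (IH1 _ eta20) (IH2 _ eta20) => n H1 H2 a ba a1.
have bS1 := tensor_bmfun tS1; have bS2 := tensor_bmfun tS2.
have bB1' := cbfun_bmfun bB1; have bB2' := cbfun_bmfun bB2.
have baw : bmfun (fun z : borel X * borel Y => a z.1 * w_ n z.2).
  by apply: bmfunM; [exact: bmfun_fst|exact: bmfun_snd].
under eq_Rintegral do rewrite mulrDr.
under [X in _ - X]eq_Rintegral do rewrite mulrDr.
rewrite !bmfun_integralD; try exact: bmfunM.
rewrite opprD addrACA (le_trans (ler_normD _ _))// [leRHS]splitr lerD//.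
- exact: H1.
- exact: H2.
Qed.

(** [f] is replaced by a tensor [T]; the multipliers are bounded by [L] and [M], so this costs at
    most [L * (M + 1)] times the mean error of [T]. *)
Lemma continuous_weight (w_ : nat -> Y -> R) (M L : R) (f : X * Y -> R)
    (eta : R) :
  (forall n, bmfun (w_ n : borel Y -> R)) -> (forall n y, `|w_ n y| <= M) ->
  0 < L -> continuous f -> (forall z, 0 <= f z <= 1) -> 0 < eta ->
  exists2 B : X -> R, cbfun B & \forall n \near U, forall a : borel X -> R,
    bmfun a -> (forall x, `|a x| <= L) ->
    `|\int[(mu_ n \x nu_ n)%E]_z (a z.1 * w_ n z.2 * f z)
      - \int[mu_ n]_x (a x * B x)| <= eta.
Proof.
move=> bw wM L0 cf f01 eta0.
have M0 : 0 <= M := le_trans (normr_ge0 _) (wM 0%N point).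
pose K1 := L * (M + 1).
have K10 : 0 < K1 by rewrite mulr_gt0// ltr_wpDl.
have e0 : 0 < eta / 2 / K1 by rewrite !divr_gt0.
have [T tT [_ nT]] := continuous_tensor_approx cf f01 e0.
have [B bB BT] := tensor_weight bw wM L0 tT.
have eta20 : 0 < eta / 2 by rewrite divr_gt0.
exists B => //; apply: filterS2 nT (BT _ eta20) => n Hn Bn a ba aL.
have bf : bmfun (f : (borel X * borel Y)%type -> R).
  split; first exact: continuous_prod_measurable.
  by exists 1 => z; have /andP[? ?] := f01 z; rewrite ger0_norm.
have bT := tensor_bmfun tT.
have baw : bmfun (fun z : borel X * borel Y => a z.1 * w_ n z.2).
  by apply: bmfunM; [exact: bmfun_fst|exact: bmfun_snd].
rewrite (le_trans (ler_distD
  (\int[(mu_ n \x nu_ n)%E]_z (a z.1 * w_ n z.2 * T z)) _ _))//.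
rewrite [leRHS]splitr lerD//; last exact: Bn.
have bfT : bmfun (fun z : borel X * borel Y => `|f z - T z|).
  exact/bmfun_norm/bmfunB.
apply: (@le_trans _ _ (\int[(mu_ n \x nu_ n)%E]_z (K1 * `|f z - T z|))).
  apply: bmfun_integral_dist; try exact: bmfunM.
    by apply: bmfunM => //; exact: bmfun_cst.
  move=> z; rewrite -mulrBr normrM ler_wpM2r// normrM ler_pM//.
  by rewrite (le_trans (wM n _))// lerDl.
by rewrite bmfun_integralZl// -ler_pdivlMl// mulrC.
Qed.

End weak_limits.

(** * Limits of potentials *)

Section truncations.
Context {R : realType}.
Implicit Types (M t : R).

Definition le_ind M t : R := \1_(`]-oo, M]%classic) t.

(** A sharp cutoff, in contrast to [exp_cap]: it arises when [exp t] is tested against a function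
    carried by the event [t <= M]. *)
Definition exp_trunc M t : R := le_ind M t * expR t.

Definition exp_cap M t : R := expR (Num.min t M).

Lemma le_indE M t : le_ind M t = (t <= M)%R%:R.
Proof.
by rewrite /le_ind indicE; congr ((_ : bool)%:R);
  apply/idP/idP => [/set_mem|?]; [|apply/mem_set]; rewrite /= in_itv.
Qed.

Lemma bmfun_le_ind M : bmfun (le_ind M).
Proof.
split; first by apply: measurable_indic; exact: measurable_itv.
by exists 1 => t; rewrite le_indE normr_nat lern1 leq_b1.
Qed.

Lemma exp_trunc_ge0 M t : 0 <= exp_trunc M t.
Proof. by rewrite /exp_trunc le_indE mulr_ge0// expR_ge0. Qed.

Lemma exp_trunc_le M t : exp_trunc M t <= expR M.
Proof.
rewrite /exp_trunc le_indE; case: (leP t M); rewrite ?mul1r ?mul0r ?expR_ge0//.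
by rewrite ler_expR.
Qed.

Lemma bmfun_exp_trunc M : bmfun (exp_trunc M).
Proof.
split.
  apply: measurable_funM; first by have [] := bmfun_le_ind M.
  exact: measurable_expR.
by exists (expR M) => t; rewrite ger0_norm ?exp_trunc_ge0// exp_trunc_le.
Qed.

Lemma exp_cap_ge0 M t : 0 <= exp_cap M t.
Proof. exact: expR_ge0. Qed.

Lemma exp_cap_le M t : exp_cap M t <= expR M.
Proof. by rewrite ler_expR ge_min lexx orbT. Qed.

Lemma bmfun_exp_cap M : bmfun (exp_cap M).
Proof.
split.
  apply: measurableT_comp; first exact: measurable_expR.
  by apply: measurable_minr => //; exact: measurable_cst.
by exists (expR M) => t; rewrite ger0_norm ?exp_cap_ge0// exp_cap_le.
Qed.

Lemma bmfun_comp d (T : measurableType d) (h : R -> R) (f : T -> R) :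
  bmfun h -> measurable_fun setT f -> bmfun (fun x => h (f x)).
Proof.
move=> [mh [M hM]] mf; split; first exact: (measurableT_comp mh mf).
by exists M.
Qed.

End truncations.

(** For negative [t], [exp t <= 1 / (1 - t)] gives [1 - exp t >= - t / (1 - t)], which is at least
    [- t / 2] if [- t < 1] and at least [1 / 2] otherwise; hence the factor 2. *)
Lemma min_norm_le_expR {R : realType} (t : R) :
  Num.min 1 `|t| <= 2 * `|expR t - 1|.
Proof.
have [t0|t0] := leP 0 t.
  have := expR_ge1Dx t; move: (expR t) => e et.
  rewrite ge_min (ger0_norm t0) (@ger0_norm _ (e - 1)); last by lra.
  by apply/orP; right; lra.
have u0 : 0 < - t by rewrite oppr_gt0.
have e0 := expR_gt0 t.
have : expR t * (1 - t) <= 1.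
  by rewrite -[leRHS](expRxMexpNx_1 t) ler_pM2l// expR_ge1Dx.
move: (expR t) e0 => e e0 et.
have e1 : e < 1 by nra.
rewrite (ltr0_norm t0) (@ltr0_norm _ (e - 1)); last by lra.
have [t1|t1] := leP 1 (- t); nra.
Qed.

Lemma bmfun_dist1 d (T : measurableType d) (R : realType) (f : T -> R) :
  measurable_fun setT f -> bmfun (fun x => Num.min 1 `|f x|).
Proof.
move=> mf; split.
  by apply: measurable_minr; [exact: measurable_cst|exact: measurableT_comp].
by exists 1 => x; rewrite ger0_norm ?ge_min ?lexx// le_min ler01 normr_ge0.
Qed.

(** * Approximation of potentials by continuous functions *)

Section potential_approximation.
Context {R : realType} {X Y : ptopologicalType}.
Hypotheses (polishX : polish R X) (polishY : polish R Y).
Variable (U : set_system nat).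
Hypothesis (UU : UltraFilter U).
Variables (mu_ : nat -> probability (borel X) R) (mu : probability (borel X) R).
Variables (nu_ : nat -> probability (borel Y) R) (nu : probability (borel Y) R).
Hypotheses (mu_cvg : wcvg_along U mu_ mu) (nu_cvg : wcvg_along U nu_ nu).
Variables (k : X * Y -> R) (f_ : nat -> X -> R) (g_ : nat -> Y -> R) (K : R).
Hypotheses (ck : continuous k) (k01 : forall z, 0 <= k z <= 1).
Hypotheses (mf_ : forall n, measurable_fun [set: borel X] (f_ n)).
Hypotheses (mg_ : forall n, measurable_fun [set: borel Y] (g_ n)).
Hypothesis f_tight : forall n (M : R), 0 < M ->
  \int[mu_ n]_x (1 - le_ind M (f_ n x)) <= K / M.
(** The Schrodinger equation multiplied by [exp f_n] and tested against [s] on the event [f_n <= N];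
    [K / M] is the price of capping [g_ n] at [M]. The kernel [k] is abstract so that the
    coordinates may be exchanged. *)
Hypothesis schrodinger : forall n (M N : R) (s : borel X -> R), 0 < M ->
  bmfun s -> (forall x, `|s x| <= 1) ->
  `|\int[(mu_ n \x nu_ n)%E]_z
       (s z.1 * exp_trunc N (f_ n z.1) * exp_cap M (g_ n z.2) * k z)
    - \int[mu_ n]_x (s x * le_ind N (f_ n x))| <= K / M.

(** [continuous_weight] replaces the integral of [exp_cap M (g_ n y) * k] over [y] by a continuous
    [B] that does not depend on [n]. The equation then says that [exp f_n * B] is near 1 where
    [f_n <= M], so [f_n] is near [- ln B]. *)
Lemma potential_approx (e : R) : 0 < e -> exists2 h : X -> R, cbfun h &
  \forall n \near U, \int[mu_ n]_x Num.min 1 `|f_ n x - h x| <= e.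
Proof.
move=> e0; have K0 : 0 <= K.
  have := f_tight 0%N ltr01; rewrite divr1; apply: le_trans.
  by apply: Rintegral_ge0 => x _; rewrite le_indE subr_ge0 lern1 leq_b1.
pose M := 8 * K / e + 1.
have M0 : 0 < M by rewrite ltr_wpDl// divr_ge0// ?mulr_ge0// ltW.
have KM : K / M <= e / 8.
  rewrite ler_pdivrMr// /M mulrDr mulr1.
  rewrite (_ : e / 8 * (8 * K / e) = K); last by field; rewrite gt_eqF.
  by rewrite lerDl divr_ge0// ltW.
have e80 : 0 < e / 8 by rewrite divr_gt0.
have bcap n : bmfun (fun y : borel Y => exp_cap M (g_ n y)).
  by apply: bmfun_comp => //; exact: bmfun_exp_cap.
have capM n y : `|exp_cap M (g_ n y)| <= expR M.
  by rewrite ger0_norm ?exp_cap_ge0 ?exp_cap_le.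
have [B bB nB] := continuous_weight polishX polishY UU mu_cvg nu_cvg bcap capM
  (expR_gt0 M) ck k01 e80.
(* [B] may come close to 0 or be negative, so it is floored before taking the logarithm. At this
   height the floor is harmless: if [f_n <= M] and [B < r], then [exp f_n * B <= 1 / 2], and
   [2 * |D|] is already at least 1. *)
pose r := expR (- M) / 2.
have r0 : 0 < r by rewrite divr_gt0// expR_gt0.
pose h x := - ln (Num.max (B x) r).
have maxr0 x : 0 < Num.max (B x) r by rewrite lt_max r0 orbT.
have [cB [b Bb]] := bB.
have ch : continuous h.
  move=> x; apply: cvgN.
  apply: (@continuous_comp _ _ _ (fun x => Num.max (B x) r) (@ln R)).
    by apply: (@continuous_max _ _ B (fun=> r)); [exact: cB|exact: cvg_cst].
  exact: continuous_ln.
have bh : cbfun h.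
  split=> //; exists (`|ln r| + `|ln (Num.max b r)|) => x; rewrite normrN.
  have br0 : 0 < Num.max b r by rewrite lt_max r0 orbT.
  have h1 : ln r <= ln (Num.max (B x) r).
    by rewrite ler_ln ?posrE// le_max lexx orbT.
  have h2 : ln (Num.max (B x) r) <= ln (Num.max b r).
    rewrite ler_ln ?posrE// ge_max !le_max lexx orbT andbT.
    by rewrite (le_trans (ler_norm _) (Bb x)).
  move: h1 h2; move: (ln _) (ln _) (ln _) => u v w uv vw.
  have := ler_norm (- w); rewrite normrN; have := ler_norm u.
  have := normr_ge0 u; have := normr_ge0 w.
  by rewrite ler_norml => *; apply/andP; split; lra.
exists h => //; apply: filterS nB => n nB.
have bB' := cbfun_bmfun bB.
have btr : bmfun (fun x : borel X => exp_trunc M (f_ n x)).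
  by apply: bmfun_comp => //; exact: bmfun_exp_trunc.
have bind : bmfun (fun x : borel X => le_ind M (f_ n x)).
  by apply: bmfun_comp => //; exact: bmfun_le_ind.
pose D (x : borel X) := exp_trunc M (f_ n x) * B x - le_ind M (f_ n x).
have bD : bmfun D by apply: bmfunB => //; exact: bmfunM.
have intD : \int[mu_ n]_x `|D x| <= e / 4.
  (* The sign of [D], with value 1 at 0: testing the equation against it yields the integral of the
     absolute value of [D]. *)
  pose s (x : borel X) : R := 2 * le_ind 0 (- D x) - 1.
  have bs : bmfun s.
    apply: bmfunB; last exact: bmfun_cst.
    apply: bmfunM; first exact: bmfun_cst.
    apply: bmfun_comp; first exact: bmfun_le_ind.
    by apply: measurableT_comp => //; have [] := bD.
  have sD x : s x * D x = `|D x|.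
    rewrite /s le_indE oppr_le0; case: leP => Dx.
      by rewrite ger0_norm//= mulr1 addrK mul1r.
    by rewrite ltr0_norm//= mulr0 sub0r mulN1r.
  have s1 x : `|s x| <= 1.
    rewrite /s le_indE; case: (- D x <= 0)%R; rewrite /= ?mulr1 ?mulr0.
      by rewrite ger0_norm; lra.
    by rewrite ler0_norm; lra.
  under eq_Rintegral do rewrite -sD mulrBr mulrA.
  have bst : bmfun (fun x : borel X => s x * exp_trunc M (f_ n x)) by exact: bmfunM.
  have stM x : `|s x * exp_trunc M (f_ n x)| <= expR M.
    rewrite normrM -[leRHS]mul1r ler_pM//.
    by rewrite ger0_norm ?exp_trunc_ge0 ?exp_trunc_le.
  rewrite bmfun_integralB; [|exact: bmfunM..].
  have := nB _ bst stM; have := schrodinger n M M0 bs s1.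
  rewrite !ler_norml => /andP[H1 H2] /andP[H3 H4]; lra.
(* The tail contributes at most [e / 8] and the defect of the equation [2 * (e / 4)]. *)
apply: (@le_trans _ _ (\int[mu_ n]_x ((1 - le_ind M (f_ n x)) + 2 * `|D x|))).
  apply: le_bmfun_integral.
  - apply: bmfun_dist1; apply: measurable_funB => //.
    exact: continuous_borel_measurable.
  - apply: bmfunD; first by apply: bmfunB => //; exact: bmfun_cst.
    by apply: bmfunM; [exact: bmfun_cst|exact: bmfun_norm].
  move=> x; rewrite /D /exp_trunc le_indE; case: (leP (f_ n x) M) => fM; last first.
    by rewrite subr0 ge_min lerDl mulr_ge0.
  rewrite subrr add0r mul1r /h; have [Br|Br] := ltP (B x) r; last first.
    have B0 : 0 < B x := lt_le_trans r0 Br.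
    rewrite opprK -[X in expR _ * X](lnK B0) -expRD.
    exact: min_norm_le_expR.
  rewrite ge_min; apply/orP; left.
  have : expR (f_ n x) * B x <= 1 / 2.
    apply: (@le_trans _ _ (expR (f_ n x) * r)).
      by rewrite ler_wpM2l ?expR_ge0// ltW.
    apply: (@le_trans _ _ (expR M * r)).
      by rewrite ler_wpM2r ?(ltW r0)// ler_expR.
    by rewrite /r mulrA expRxMexpNx_1.
  rewrite (_ : true%:R = 1)//; move: (_ * _) => u u12; rewrite ler0_norm; lra.
rewrite bmfun_integralD.
- rewrite bmfun_integralZl; last exact: bmfun_norm.
  by have := f_tight n M0; lra.
- by apply: bmfunB => //; exact: bmfun_cst.
- by apply: bmfunM; [exact: bmfun_cst|exact: bmfun_norm].
Qed.

End potential_approximation.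

Lemma min_norm_triangle {R : realType} (x y z : R) :
  Num.min 1 `|x - z| <= Num.min 1 `|x - y| + Num.min 1 `|y - z|.
Proof.
have := ler_distD y x z; have := normr_ge0 (x - y); have := normr_ge0 (y - z).
move: `|x - y| `|y - z| `|x - z| => a b c b0 a0 cab.
by rewrite ge_min; case: (leP 1 a); case: (leP 1 b); case: (leP 1 c) => /=; lra.
Qed.

(** The terms of the series tend to 0, so from some rank on the minimum with 1 is inactive and the
    increments are absolutely summable. *)
Lemma summable_dist_cvg {R : realType} (u : nat -> R) :
  cvgn (series (fun p => Num.min 1 `|u p.+1 - u p|)) -> cvgn u.
Proof.
move=> cS; have /cvgrPdist_lt/(_ 1 ltr01)[N _ NP] := cvg_series_cvg_0 cS.
suff : cvgn (series (telescope u)).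
  have uE : u = (fun n => u 0%N + series (telescope u) n).
    by apply/funext => n; exact: eq_sum_telescope.
  by move=> c; rewrite uE; apply: is_cvgD => //; exact: is_cvg_cst.
apply: normed_cvg; rewrite -(is_cvg_series_restrict N).
rewrite -(is_cvg_series_restrict N) in cS.
suff <- : [sequence \sum_(N <= k < n) Num.min 1 `|u k.+1 - u k|]_n =
          [sequence \sum_(N <= k < n) `|telescope u k|]_n by [].
apply/funext => n /=; apply: eq_big_nat => k /andP[/NP /= + _].
rewrite sub0r normrN ger0_norm ?le_min ?ler01 ?normr_ge0//.
by rewrite gt_min ltxx/= => k1; rewrite min_r// ltW.
Qed.

(** The sum of the truncated increments has finite integral, hence is finite almost everywhere. *)
Lemma ae_cvg_of_summable d (T : measurableType d) (R : realType)
    (P : probability T R) (h : nat -> T -> R) (C : R) :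
  (forall p, measurable_fun setT (h p)) ->
  (forall p, \int[P]_x Num.min 1 `|h p.+1 x - h p x| <= C * 2^-1 ^+ p) ->
  {ae P, forall x, cvgn (h ^~ x)}.
Proof.
move=> mh hC; have C0 : 0 <= C.
  have := hC 0%N; rewrite expr0 mulr1; apply: le_trans.
  by apply: Rintegral_ge0 => x _; rewrite le_min ler01 normr_ge0.
pose a p x := Num.min 1 `|h p.+1 x - h p x|.
have a0 p x : 0 <= a p x by rewrite le_min ler01 normr_ge0.
have ba p : bmfun (a p) by apply: bmfun_dist1; exact: measurable_funB.
pose S x := (\sum_(p <oo) (a p x)%:E)%E.
have mS : measurable_fun setT S.
  apply: ge0_emeasurable_sum => [p x _ _|p _]; first by rewrite lee_fin.
  by apply/measurable_EFinP; have [] := ba p.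
have S0 x : (0 <= S x)%E by apply: nneseries_ge0 => p _ _; rewrite lee_fin.
have intS : P.-integrable setT S.
  apply/integrableP; split => //.
  under eq_integral do rewrite gee0_abs//.
  rewrite integral_nneseries//; last 2 first.
  - by move=> p; apply/measurable_EFinP; have [] := ba p.
  - by move=> p x _; rewrite lee_fin.
  apply: (@le_lt_trans _ _ (C * (1 - 2^-1)^-1)%:E); last exact: ltry.
  apply: lime_le.
    by apply: is_cvg_nneseries => p _ _; apply: integral_ge0 => x _; rewrite lee_fin.
  apply: nearW => n; rewrite (eq_bigr (fun p => (\int[P]_x a p x)%:E)); last first.
    by move=> p _; rewrite bmfun_integralE.
  rewrite sumEFin lee_fin.
  apply: le_trans (@geometric_le_lim _ n C 2^-1 C0 _ _).
  - by apply: ler_sum => p _; exact: hC.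
  - by rewrite invr_gt0.
  - by rewrite ger0_norm ?invr_ge0// invf_lt1// ltr1n.
apply: filterS (integrable_ae measurableT intS) => x /(_ I) Sfin.
apply: summable_dist_cvg; apply: nondecreasing_is_cvgn.
  by apply: nondecreasing_series => n _ _; exact: a0.
exists (fine (S x)) => _ [n _ <-]; rewrite -lee_fin fineK// /series/=.
by rewrite -sumEFin; apply: nneseries_lim_ge => k _ _; rewrite lee_fin.
Qed.

(** * Limits of functions under varying measures *)

Section limit_function.
Context {R : realType} {X : ptopologicalType}.
Variable (U : set_system nat).
Hypothesis (UU : ProperFilter U).
Variables (mu_ : nat -> probability (borel X) R) (mu : probability (borel X) R).
Hypotheses (mu_cvg : wcvg_along U mu_ mu).
Variable (f_ : nat -> X -> R).
Hypotheses (mf_ : forall n, measurable_fun [set: borel X] (f_ n)).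

(* [f] is the limit of [f_ n] along [U], although [f_ n] is controlled by
   [mu_ n] and [f] by [mu] only: both are compared to continuous functions. *)
Definition approx_limit (f : X -> R) := measurable_fun [set: borel X] f /\
  exists h : nat -> X -> R, [/\ forall p, cbfun (h p),
    forall p, \forall n \near U,
      \int[mu_ n]_x Num.min 1 `|f_ n x - h p x| <= 2^-1 ^+ p &
    {ae mu, forall x, h ^~ x @ \oo --> f x}].

(** Consecutive approximants are both close to [f_ n] under [mu_ n]. Their truncated distance is
    bounded and continuous, so weak convergence makes it small under [mu], and the errors are
    summable in [p]. *)
Lemma approx_limit_exists :
  (forall e : R, 0 < e -> exists2 h : X -> R, cbfun h &
    \forall n \near U, \int[mu_ n]_x Num.min 1 `|f_ n x - h x| <= e) ->
  exists f, approx_limit f.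
Proof.
move=> fh; have e0 p : 0 < 2^-1 ^+ p :> R by rewrite exprn_gt0// invr_gt0.
have /choice[h hP] : forall p : nat, exists h : X -> R, cbfun h /\
    \forall n \near U, \int[mu_ n]_x Num.min 1 `|f_ n x - h x| <= 2^-1 ^+ p.
  by move=> p; have [h bh nh] := fh _ (e0 p); exists h.
have bh p : cbfun (h p) by have [] := hP p.
have mh p : measurable_fun [set: borel X] (h p).
  by apply: continuous_borel_measurable; have [] := bh p.
have hcvg : {ae mu, forall x : borel X, cvgn (h ^~ x)}.
  (* The constant 2 covers the sum of the errors at ranks [p] and [p.+1]. *)
  apply: (@ae_cvg_of_summable _ _ _ _ (h : nat -> borel X -> R) 2) => // p.
  have bd : cbfun (fun x => Num.min 1 `|h p.+1 x - h p x|).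
    have bB : cbfun (fun x => h p.+1 x - h p x).
      have bN : cbfun (fun x => -1 * h p x) by apply: cbfunM; [exact: cbfun_cst|].
      by have := cbfunD (bh p.+1) bN; under eq_fun do rewrite mulN1r.
    apply: (@cbfun_comp _ _ _ (fun t : R => Num.min 1 `|t|)) bB _ => t.
    apply: (@continuous_min _ _ (fun=> 1) (fun t : R => `|t|)).
      exact: cvg_cst.
    exact: norm_continuous.
  have d0 x : 0 <= Num.min 1 `|h p.+1 x - h p x| by rewrite le_min ler01 normr_ge0.
  apply: le_trans (ler_norm _) _.
  have := @cvg_norm_bound R U _ _ (2 * 2^-1 ^+ p) UU (mu_cvg bd); apply => e epos.
  have [[_ n1] [_ n2]] := (hP p, hP p.+1).
  apply: filterS2 n1 n2 => n H1 H2; rewrite ger0_norm ?Rintegral_ge0//.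
  have bm q : bmfun (fun x : borel X => Num.min 1 `|f_ n x - h q x|).
    by apply: bmfun_dist1; exact: measurable_funB.
  apply: (@le_trans _ _ (\int[mu_ n]_x (Num.min 1 `|f_ n x - h p.+1 x| +
                                        Num.min 1 `|f_ n x - h p x|))).
    apply: le_bmfun_integral; [exact: cbfun_bmfun|exact: bmfunD|].
    by move=> x; rewrite (distrC (f_ n x) (h p.+1 x)) min_norm_triangle.
  rewrite bmfun_integralD// (le_trans (lerD H2 H1))//.
  rewrite exprS; move: (_ ^+ p) (e0 p) => r; lra.
(* The upper limit is measurable everywhere and is the limit wherever there is one; [fine] gives 0
   where it is infinite. *)
pose f (x : borel X) : R := fine (limn_esup (fun p => (h p x)%:E)).
exists f; split.
  apply: measurableT_comp => //; apply: measurable_fun_limn_esup => p.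
  exact/measurable_EFinP.
exists h; split => //; first by move=> p; have [] := hP p.
apply: filterS hcvg => x /cvg_ex[l hl].
have El : (fun p => (h p x)%:E) @ \oo --> l%:E by apply: cvg_EFin => //; exact: nearW.
rewrite /f is_cvg_limn_esupE; last by apply/cvg_ex; exists l%:E.
by rewrite (cvg_lim _ El).
Qed.

(** Lipschitz for the truncated distance, that is, in the metric in which [approx_limit] measures
    errors. *)
Definition dist1_lipschitz (t : R -> R) := [/\ continuous t,
  exists M : R, forall r, `|t r| <= M &
  exists2 C : R, 0 <= C & forall r s, `|t r - t s| <= C * Num.min 1 `|r - s|].

Lemma dist1_lipschitzP (t : R -> R) (M L : R) : (forall r, `|t r| <= M) ->
  (forall r s, `|t r - t s| <= L * `|r - s|) -> dist1_lipschitz t.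
Proof.
move=> tM tL; have M0 := le_trans (normr_ge0 _) (tM 0).
have L0 : 0 <= L.
  by have := le_trans (normr_ge0 _) (tL 1 0); rewrite subr0 normr1 mulr1.
split; [move=> x|by exists M|].
  apply/cvgrPdist_le => e e0; have L1 : 0 < L + 1 by rewrite ltr_wpDl.
  near=> y; rewrite (le_trans (tL _ _))//.
  apply: (@le_trans _ _ ((L + 1) * `|x - y|)); first by rewrite ler_wpM2r ?lerDl.
  rewrite mulrC -ler_pdivlMr//; near: y.
  by apply: cvgr_dist_le; [exact: cvg_id|rewrite divr_gt0].
(* Points at distance at least 1 use the bound [2 * M], closer ones the Lipschitz constant [L]. *)
exists (L + 2 * M) => [|r s]; first by rewrite addr_ge0 ?mulr_ge0.
have [rs|rs] := leP 1 `|r - s|.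
  rewrite mulr1 (le_trans (ler_normB _ _))//.
  by have := tM r; have := tM s; lra.
by rewrite (le_trans (tL _ _))// ler_wpM2r// lerDl mulr_ge0.
Unshelve. all: by end_near. Qed.

Lemma dist1_lipschitz_bmfun (t : R -> R) : dist1_lipschitz t -> bmfun t.
Proof. by move=> [ct bt _]; split => //; exact: continuous_measurable_fun. Qed.

(** Three comparisons: [f] with [h p] under [mu] by dominated convergence, [mu] with [mu_ n] on the
    continuous function built from [h p], and [h p] with [f_ n] under [mu_ n] by the Lipschitz
    bound. The rank [p] is fixed before [n] varies. *)
Lemma approx_limit_integral (f : X -> R) (phi : X -> R) (t : R -> R) :
  approx_limit f -> cbfun phi -> dist1_lipschitz t ->
  (fun n => \int[mu_ n]_x (phi x * t (f_ n x))) @ U -->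
  \int[mu]_x (phi x * t (f x)).
Proof.
move=> [mf [h [bh nh hf]]] bphi lt; have bt := dist1_lipschitz_bmfun lt.
have [ct [M tM] [C C0 tC]] := lt.
have [_ [N phiN]] := bphi; have N0 := le_trans (normr_ge0 _) (phiN point).
have bphi' := cbfun_bmfun bphi.
have e0 p : 0 < 2^-1 ^+ p :> R by rewrite exprn_gt0// invr_gt0.
have bth p : cbfun (fun x => phi x * t (h p x)).
  by apply: cbfunM => //; exact: cbfun_comp (bh p) ct.
have mh p : measurable_fun [set: borel X] (h p).
  by apply: continuous_borel_measurable; have [] := bh p.
have btf (g : borel X -> R) : measurable_fun setT g ->
    bmfun (fun x : borel X => phi x * t (g x)).
  by move=> mg; apply: bmfunM => //; exact: bmfun_comp.
have dc : (fun p => \int[mu]_x (phi x * t (h p x))) @ \oo -->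
    \int[mu]_x (phi x * t (f x)).
  apply: (@ae_bmfun_dominated _ _ _ _ _ _ (N * M)).
  - by move=> p; have [] := btf _ (mh p).
  - by have [] := btf _ mf.
  - by move=> p x; rewrite normrM ler_pM.
  - have [A [mA A0 sA]] := hf; exists A; split=> // x /= nx; apply: sA => /= hx.
    apply: nx; apply: cvgM; first exact: cvg_cst.
    exact: (continuous_cvg _ (ct _) hx).
apply/cvgrPdist_le => e epos; have e30 : 0 < e / 3 by rewrite divr_gt0.
have NC0 : 0 < N * C + 1 by rewrite ltr_wpDl// mulr_ge0.
have [p [/= p1 p2]] : exists p,
    `|\int[mu]_x (phi x * t (f x)) - \int[mu]_x (phi x * t (h p x))| <= e / 3 /\
    (N * C) * 2^-1 ^+ p <= e / 3.
  have /cvgrPdist_le/(_ _ e30) H1 := dc.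
  have : (fun p => 2^-1 ^+ p : R) @ \oo --> (0 : R).
    by apply: cvg_expr; rewrite ger0_norm ?invr_ge0// invf_lt1// ltr1n.
  have NCe : 0 < e / 3 / (N * C + 1) by rewrite divr_gt0.
  move=> /cvgrPdist_le/(_ _ NCe) H2.
  have [p [/= H3 H4]] := filter_ex (filterI H1 H2).
  exists p; split=> //; move: H4.
  rewrite sub0r normrN (ger0_norm (ltW (e0 p))) ler_pdivlMr// mulrC.
  by apply: le_trans; rewrite ler_wpM2r ?(ltW (e0 p))// lerDl.
have /cvgrPdist_le/(_ _ e30) H2 := mu_cvg (bth p).
apply: filterS2 H2 (nh p) => n H2 H3.
have H4 : `|\int[mu_ n]_x (phi x * t (h p x)) - \int[mu_ n]_x (phi x * t (f_ n x))|
    <= e / 3.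
  apply: le_trans p2.
  apply: le_trans (ler_wpM2l (mulr_ge0 N0 C0) H3).
  have bd : bmfun (fun x : borel X => Num.min 1 `|f_ n x - h p x|).
    by apply: bmfun_dist1; exact: measurable_funB.
  rewrite -bmfun_integralZl//; apply: bmfun_integral_dist; [exact: btf..| |].
    by apply: bmfunM => //; exact: bmfun_cst.
  move=> x; rewrite -mulrBr normrM -mulrA ler_pM//.
  by rewrite distrC (distrC (f_ n x)) distrC; exact: tC.
move: p1 H2 H4; rewrite !ler_norml => /andP[? ?] /andP[? ?] /andP[? ?].
by apply/andP; split; lra.
Qed.

End limit_function.

(** * Couplings of Gibbs form *)

Section densities.
Context d (T : measurableType d) (R : realType).
Implicit Types (pi P : probability T R) (q u : T -> R).

Definition is_density pi P q := [/\ measurable_fun setT q, pi `<< P &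
  {ae P, forall z, density pi P z = (q z)%:E}].

Lemma bounded_bmfun (k : T -> R) : bmfun k -> [bounded k x | x in setT].
Proof.
move=> [_ [M kM]]; exists M; split; first exact: num_real.
by move=> r Mr x _; exact: le_trans (kM x) (ltW Mr).
Qed.

Lemma is_density_integral pi P q (k : T -> R) : is_density pi P q -> bmfun k ->
  P.-integrable setT (EFin \o (fun z => k z * q z)) /\
  \int[pi]_z k z = \int[P]_z (k z * q z).
Proof.
move=> [mq piP dq] bk; have [mk _] := bk.
have iD : P.-integrable setT (density pi P) by exact: Radon_Nikodym_integrable.
have iq : P.-integrable setT (EFin \o q).
  move/integrableP : iD => [mD iD]; apply/integrableP; split.
    exact/measurable_EFinP.
  rewrite (@ae_eq_integral _ _ _ _ setT (abse \o density pi P))//.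
  - by apply/measurableT_comp => //; exact/measurable_EFinP.
  - exact: measurableT_comp.
  - by apply: filterS dq => z + _ /= => ->.
have ik := integrableMr measurableT mk (bounded_bmfun bk) iq.
split; first exact: ik.
rewrite /Rintegral; congr fine.
rewrite -(Radon_Nikodym_change_of_variables piP measurableT (bmfun_integrable _ bk)).
apply: ae_eq_integral => //.
- by apply: emeasurable_funM; [exact/measurable_EFinP|exact: measurable_int iD].
- exact: measurable_int ik.
- by apply: filterS dq => z + _ => /=; rewrite /density => ->; rewrite EFinM.
Qed.

Lemma is_density_of_integral pi P q : measurable_fun setT q ->
  (forall z, 0 <= q z) ->
  (forall A, measurable A -> pi A = (\int[P]_(z in A) (q z)%:E)%E) ->
  is_density pi P q.
Proof.
move=> mq q0 piq; have piP : pi `<< P.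
  apply/null_content_dominatesP => A mA PA0; rewrite piq//.
  apply: null_set_integral => //; apply: measurable_funTS.
  exact/measurable_EFinP.
have iD : P.-integrable setT (density pi P) by exact: Radon_Nikodym_integrable.
split => //.
have : ae_eq P setT (density pi P) (EFin \o q).
  apply: integral_ae_eq => //; first exact/measurable_EFinP.
  by move=> A _ mA; rewrite -piq// -Radon_Nikodym_integral.
by apply: filterS => z; apply.
Qed.

(** Monotone convergence turns bounds on bounded truncations into a bound on the extended-real
    integral. *)
Lemma integral_le_of_min P u (K : R) : measurable_fun setT u ->
  (forall x, 0 <= u x) ->
  (forall N : nat, \int[P]_x Num.min (u x) N%:R <= K) ->
  (\int[P]_x (u x)%:E <= K%:E)%E.
Proof.
move=> mu u0 uK.
have bu N : bmfun (fun x => Num.min (u x) N%:R).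
  split; first by apply: measurable_minr => //; exact: measurable_cst.
  by exists N%:R => x; rewrite ger0_norm ?ge_min ?lexx ?orbT// le_min u0 ler0n.
have H : (fun N : nat => \int[P]_x (Num.min (u x) N%:R)%:E)%E @ \oo -->
    (\int[P]_x (u x)%:E)%E.
  rewrite (eq_integral
      (fun x => limn (fun N : nat => (Num.min (u x) N%:R)%:E))); last first.
    move=> x _; apply/esym/cvg_lim => //; apply: cvg_near_cst; near=> n.
    by congr EFin; rewrite min_l//; near: n; exact: nbhs_infty_ger.
  apply: cvg_monotone_convergence => //.
  - by move=> n; apply/measurable_EFinP; have [] := bu n.
  - by move=> n x _; rewrite lee_fin le_min u0 ler0n.
  - move=> x _ m n mn; rewrite lee_fin le_min ge_min lexx/= ge_min.
    by rewrite ler_nat mn orbT.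
rewrite -(cvg_lim _ H)//; apply: lime_le; first by apply/cvg_ex; eexists; exact: H.
by apply: nearW => N; rewrite bmfun_integralE// lee_fin.
Unshelve. all: by end_near. Qed.

End densities.

Section couplings.
Context {R : realType} {X Y : ptopologicalType}.
Variables (mu : probability (borel X) R) (nu : probability (borel Y) R).
Variable pi : probability (borel X * borel Y)%type R.
Hypothesis cpi : coupling mu nu pi.

Lemma coupling_integral_fst (f : borel X -> R) : bmfun f ->
  \int[pi]_z f z.1 = \int[mu]_x f x.
Proof.
move=> bf; rewrite /Rintegral; congr fine.
have ifst := bmfun_integrable pi (bmfun_fst (borel Y) bf).
have [mf _] := bf; have [cX _] := cpi.
rewrite [RHS](@eq_measure_integral _ _ _ _ (pushforward pi fst)); last first.
  by move=> A mA _; exact/esym/cX.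
by rewrite integral_pushforward//; exact/measurable_EFinP.
Qed.

Lemma coupling_integral_snd (g : borel Y -> R) : bmfun g ->
  \int[pi]_z g z.2 = \int[nu]_y g y.
Proof.
move=> bg; rewrite /Rintegral; congr fine.
have isnd := bmfun_integrable pi (bmfun_snd (borel X) bg).
have [mg _] := bg; have [_ cY] := cpi.
rewrite [RHS](@eq_measure_integral _ _ _ _ (pushforward pi snd)); last first.
  by move=> A mA _; exact/esym/cY.
by rewrite integral_pushforward//; exact/measurable_EFinP.
Qed.

End couplings.

Lemma measurable_oplus {R : realType} d1 d2 (T1 : measurableType d1)
    (T2 : measurableType d2) (f : T1 -> R) (g : T2 -> R) :
  measurable_fun setT f -> measurable_fun setT g ->
  measurable_fun [set: T1 * T2] (oplus f g).
Proof.
move=> mf mg; apply: measurable_funD.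
- exact: (measurableT_comp mf measurable_fst).
- exact: (measurableT_comp mg measurable_snd).
Qed.

Lemma atan_lipschitz {R : realType} (r s : R) : `|atan r - atan s| <= `|r - s|.
Proof.
have H (a b : R) : a <= b -> `|atan b - atan a| <= `|b - a|.
  move=> ab; have [c _ ->] := @MVT_segment R (@atan R) (fun x => (1 + x ^+ 2)^-1) a b ab
    (fun x _ => is_derive1_atan x)
    (continuous_subspaceT (@continuous_atan R)).
  rewrite normrM -[leRHS]mul1r ler_wpM2r//.
  rewrite ger0_norm ?invr_ge0 ?addr_ge0 ?sqr_ge0// invf_le1 ?ltr_wpDr ?sqr_ge0//.
  by rewrite lerDl sqr_ge0.
have [rs|sr] := leP r s; last by apply: H; exact: ltW.
by rewrite distrC (distrC r); exact: H.
Qed.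

Lemma atan_bounded {R : realType} (r : R) : `|atan r| <= pi.
Proof.
have := atan_gtNpi2 r; have := atan_ltpi2 r; have := pi_ge0 R.
by rewrite ler_norml => *; apply/andP; split; lra.
Qed.

(** [atan] is odd and increasing, so [atan h + atan k] has the sign of [h + k = a - b], which is
    also that of [exp a - exp b]. *)
Lemma atan_add_sign {R : realType} (h k a b : R) :
  h + k = a - b ->
  0 <= (atan h + atan k) * (expR a - expR b) /\
  ((atan h + atan k) * (expR a - expR b) = 0 -> h + k = 0).
Proof.
move=> hk; have -> : atan h + atan k = atan h - atan (- k) by rewrite atanN opprK.
have [ab|ab|ab] := ltgtP a b.
- have hk0 : h < - k by rewrite -subr_lt0 opprK hk subr_lt0.
  have h1 : atan h - atan (- k) < 0 by rewrite subr_lt0 lt_atan.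
  have h2 : expR a - expR b < 0 by rewrite subr_lt0 ltr_expR.
  split; first by rewrite mulr_le0// ltW.
  by move=> /eqP; rewrite mulf_eq0 !lt_eqF.
- have hk0 : - k < h by rewrite -subr_gt0 opprK hk subr_gt0.
  have h1 : 0 < atan h - atan (- k) by rewrite subr_gt0 lt_atan.
  have h2 : 0 < expR a - expR b by rewrite subr_gt0 ltr_expR.
  split; first by rewrite mulr_ge0// ltW.
  by move=> /eqP; rewrite mulf_eq0 !gt_eqF.
- by rewrite hk ab !subrr mulr0.
Qed.

Section uniqueness.
Context {R : realType} {X Y : ptopologicalType}.
Variable (c : X * Y -> R).
Variables (mu : probability (borel X) R) (nu : probability (borel Y) R).

(** The part of [potentials] that survives a passage to the limit: the optimality of the coupling is
    dropped, and [f (+) g] is still determined almost everywhere. *)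
Definition gibbs_coupling (f : X -> R) (g : Y -> R)
    (p : probability (borel X * borel Y)%type R) :=
  [/\ measurable_fun [set: borel X] f, measurable_fun [set: borel Y] g,
      coupling mu nu p &
      is_density p (mu \x nu)%E (fun z => expR (oplus f g z - c z))].

(* Both couplings integrate [atan (f - f') (+) atan (g - g')] to the same
   value, and this function has the sign of the difference of the densities:
   no integrability of the potentials is needed. *)
Lemma gibbs_coupling_unique (f f' : X -> R) (g g' : Y -> R)
    (p p' : probability (borel X * borel Y)%type R) :
  gibbs_coupling f g p -> gibbs_coupling f' g' p' ->
  {ae (mu \x nu)%E, forall z, oplus f g z = oplus f' g' z}.
Proof.
move=> [mf mg cp dp] [mf' mg' cp' dp'].
have batan : bmfun (@atan R).
  split; last by exists trigo.pi => r; exact: atan_bounded.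
  by apply: continuous_measurable_fun; exact: continuous_atan.
have bh : bmfun (fun x : borel X => atan (f x - f' x)).
  by apply: bmfun_comp => //; exact: measurable_funB.
have bk : bmfun (fun y : borel Y => atan (g y - g' y)).
  by apply: bmfun_comp => //; exact: measurable_funB.
pose w (z : borel X * borel Y) := atan (f z.1 - f' z.1) + atan (g z.2 - g' z.2).
have bw : bmfun w.
  apply: bmfunD; [exact: (bmfun_fst (borel Y) bh)|exact: (bmfun_snd (borel X) bk)].
have [i1 e1] := is_density_integral dp bw.
have [i2 e2] := is_density_integral dp' bw.
pose q z := expR (oplus f g z - c z); pose q' z := expR (oplus f' g' z - c z).
have ww' : \int[p]_z w z = \int[p']_z w z.
  rewrite !bmfun_integralD; [|exact: (bmfun_fst (borel Y) bh)
    |exact: (bmfun_snd (borel X) bk)|exact: (bmfun_fst (borel Y) bh)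
    |exact: (bmfun_snd (borel X) bk)].
  rewrite (coupling_integral_fst cp bh) (coupling_integral_fst cp' bh).
  by rewrite (coupling_integral_snd cp bk) (coupling_integral_snd cp' bk).
have sgn z : 0 <= w z * q z - w z * q' z /\
    (w z * q z - w z * q' z = 0 -> oplus f g z = oplus f' g' z).
  have := @atan_add_sign R (f z.1 - f' z.1) (g z.2 - g' z.2)
    (oplus f g z - c z) (oplus f' g' z - c z) _.
  rewrite -mulrBr => /(_ _)[|s1 s2]; first by rewrite /oplus; ring.
  split; first exact: s1.
  by move=> /s2; rewrite /oplus; lra.
pose D z : R := w z * q z - w z * q' z.
have i12 : (mu \x nu)%E.-integrable setT (EFin \o D).
  exact: (integrableB measurableT i1 i2).
have int0 : (\int[(mu \x nu)%E]_z `|(D z)%:E| = 0)%E.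
  have -> : (\int[(mu \x nu)%E]_z `|(D z)%:E| = \int[(mu \x nu)%E]_z (D z)%:E)%E.
    by apply: eq_integral => z _; rewrite /= ger0_norm ?(sgn z).1.
  rewrite -[LHS]fineK; last exact: (integrable_fin_num measurableT i12).
  rewrite -[fine _]/(\int[(mu \x nu)%E]_z D z).
  by rewrite RintegralB// -e1 -e2 ww' subrr.
have [/(_ int0) + _] :=
  ae_eq_integral_abs (mu \x nu)%E measurableT (measurable_int _ i12).
by apply: filterS => z /(_ I)/= [] /(sgn z).2.
Qed.

End uniqueness.

Lemma ler_dist3 {R : realType} (a b c d e : R) : `|a - b| <= e / 3 ->
  `|c - d| <= e / 3 -> `|b - d| <= e / 3 -> `|a - c| <= e.
Proof.
rewrite !ler_norml => /andP[? ?] /andP[? ?] /andP[? ?].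
by apply/andP; split; lra.
Qed.

(** * Bounded continuous functions determine a Borel probability *)

Section cbfun_determining.
Context {R : realType} {X : ptopologicalType}.
Hypothesis polishX : polish R X.

Lemma tensor_section (Y : topologicalType) (T : X * Y -> R) (y : Y) :
  tensor T -> cbfun (fun x => T (x, y)).
Proof.
elim=> [f g bf bg|S S' _ IH _ IH']; last exact: cbfunD.
by apply: cbfunM => //=; exact: cbfun_cst.
Qed.

(** The two-variable approximation is applied to the cylinder over [A] in [X * X], and the second
    variable is frozen. *)
Lemma open_cbfun_approx (A : set X) : open A ->
  exists t : nat -> X -> R, [/\ forall k, cbfun (t k),
    forall k x, 0 <= t k x <= 1 & forall x, t ^~ x @ \oo --> (\1_A x : R)].
Proof.
move=> oA; have oW : open ((fst : X * X -> X) @^-1` A).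
  by apply: open_comp => // z _; exact: cvg_fst.
have [t [tT t01 tcvg]] := open_tensor_approx polishX polishX oW.
exists (fun k x => t k (x, point)); split.
- by move=> k; exact: tensor_section.
- move=> k x; have /andP[-> H] := t01 k (x, point).
  by rewrite (le_trans H)// indicE lern1 leq_b1.
- by move=> x; have := tcvg (x, point).
Qed.

(** Open sets form a generating class stable under intersection, and their indicators are bounded
    limits of admissible test functions. *)
Lemma borel_probability_eq (P Q : probability (borel X) R) :
  (forall f : X -> R, cbfun f -> (forall x, 0 <= f x <= 1) ->
    \int[P]_x f x = \int[Q]_x f x) ->
  forall A : set (borel X), measurable A -> P A = Q A.
Proof.
move=> PQ A mA.
apply: (@g_sigma_algebra_measure_unique _ R (borel X) (@open X) _ (fun=> setT)) => //.
- by move=> B oB; exact: sub_sigma_algebra.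
- by move=> _; exact: openT.
- by rewrite bigcup_const//; exists 0%N.
- by move=> B C; exact: openI.
- move=> B oB; have mB : measurable (B : set (borel X)) by exact: sub_sigma_algebra.
  have [t [bt t01 tcvg]] := open_cbfun_approx oB.
  have H (M : probability (borel X) R) :
      (fun k => \int[M]_x t k x) @ \oo --> fine (M B).
    rewrite -[B in M B]setIT -integral_indic//.
    rewrite -[fine _]/(\int[M]_x \1_B x).
    apply: (@ae_bmfun_dominated _ _ _ _ _ _ 1).
    + by move=> k; apply: continuous_borel_measurable; have [] := bt k.
    + exact: measurable_indic.
    + by move=> k x; have /andP[? ?] := t01 k x; rewrite ger0_norm.
    + by apply: aeW => x; exact: tcvg.
  have HP := H P; have HQ := H Q.
  rewrite -[LHS]fineK ?fin_num_measure// -[RHS]fineK ?fin_num_measure//.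
  congr EFin; rewrite -(cvg_lim _ HP)// -(cvg_lim _ HQ)//.
  have -> // : (fun k => \int[P]_x t k x) = (fun k => \int[Q]_x t k x).
  by apply/funext => k; exact: PQ.
- by move=> k; rewrite (le_lt_trans (probability_le1 P measurableT)) ?ltry.
Qed.

End cbfun_determining.

(** * Probability measures with a prescribed density *)

Section density_measure.
Context d (T : measurableType d) (R : realType).
Variables (P : probability T R) (q : T -> R).
Hypotheses (mq : measurable_fun setT q) (q0 : forall z, 0 <= q z).
Hypothesis q1 : (\int[P]_z (q z)%:E = 1)%E.

(** The proofs are arguments so that they occur in the term to which the measure and probability
    structures are attached. *)
Definition density_prob (mq : measurable_fun setT q) (q0 : forall z, 0 <= q z)
  (q1 : (\int[P]_z (q z)%:E = 1)%E) (A : set T) := (\int[P]_(z in A) (q z)%:E)%E.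

Local Notation rho := (density_prob mq q0 q1).

Let rho0 : rho set0 = 0%E.
Proof. by rewrite /density_prob integral_set0. Qed.

Let rho_ge0 A : (0 <= rho A)%E.
Proof. by apply: integral_ge0 => z _; rewrite lee_fin. Qed.

Let rho_sigma_additive : semi_sigma_additive rho.
Proof.
move=> A mA tA mUA; rewrite /density_prob ge0_integral_bigcup//=.
- apply: is_cvg_ereal_nneg_natsum_cond => n _ _.
  by apply: integral_ge0 => z _; rewrite lee_fin.
- by apply: measurable_funTS; exact/measurable_EFinP.
- by move=> z _; rewrite lee_fin.
Qed.

HB.instance Definition _ :=
  isMeasure.Build _ _ _ rho rho0 rho_ge0 rho_sigma_additive.

Let rho_setT : rho setT = 1%E. Proof. exact: q1. Qed.

HB.instance Definition _ := @Measure_isProbability.Build _ _ R rho rho_setT.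

Lemma density_probability_exists : exists p : probability T R, is_density p P q.
Proof.
by exists (rho : probability T R); exact: is_density_of_integral.
Qed.

End density_measure.

(** * Limits of integrals involving both potentials *)

Section joint_limit.
Context {R : realType} {X Y : ptopologicalType}.
Hypotheses (polishX : polish R X) (polishY : polish R Y).
Variable (U : set_system nat).
Hypothesis (UU : UltraFilter U).
Variables (mu_ : nat -> probability (borel X) R) (mu : probability (borel X) R).
Variables (nu_ : nat -> probability (borel Y) R) (nu : probability (borel Y) R).
Hypotheses (mu_cvg : wcvg_along U mu_ mu) (nu_cvg : wcvg_along U nu_ nu).
Variables (f_ : nat -> X -> R) (g_ : nat -> Y -> R).
Hypotheses (mf_ : forall n, measurable_fun [set: borel X] (f_ n)).
Hypotheses (mg_ : forall n, measurable_fun [set: borel Y] (g_ n)).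
Variables (f : X -> R) (g : Y -> R).
Hypothesis fP : approx_limit U mu_ mu f_ f.
Hypothesis gP : approx_limit U nu_ nu g_ g.

(** When [k] is a product, the integral factors into one-variable integrals, each handled by
    [approx_limit_integral]. In general [k] is replaced by a tensor close to it in mean under the
    limit product and under the moving ones. *)
Lemma joint_limit_integral (k : X * Y -> R) (t1 t2 : R -> R) :
  continuous k -> (forall z, 0 <= k z <= 1) ->
  dist1_lipschitz t1 -> dist1_lipschitz t2 ->
  (fun n => \int[(mu_ n \x nu_ n)%E]_z (k z * (t1 (f_ n z.1) * t2 (g_ n z.2))))
    @ U --> \int[(mu \x nu)%E]_z (k z * (t1 (f z.1) * t2 (g z.2))).
Proof.
move=> ck k01 lt1 lt2.
have bt1 := dist1_lipschitz_bmfun lt1; have bt2 := dist1_lipschitz_bmfun lt2.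
have [_ [M1 tM1] _] := lt1; have [_ [M2 tM2] _] := lt2.
have mf := fP.1; have mg := gP.1.
have bfg (a : borel X -> R) (b : borel Y -> R) : measurable_fun setT a ->
    measurable_fun setT b ->
    bmfun (fun z : borel X * borel Y => t1 (a z.1) * t2 (b z.2)).
  move=> ma mb; apply: bmfunM.
    exact: (bmfun_fst (borel Y) (bmfun_comp bt1 ma)).
  exact: (bmfun_snd (borel X) (bmfun_comp bt2 mb)).
have tensor_case T : tensor T ->
  (fun n => \int[(mu_ n \x nu_ n)%E]_z (T z * (t1 (f_ n z.1) * t2 (g_ n z.2))))
    @ U --> \int[(mu \x nu)%E]_z (T z * (t1 (f z.1) * t2 (g z.2))).
  elim=> [a b ba bb|S S' tS IH tS' IH'].
    have H (P : probability (borel X) R) (Q : probability (borel Y) R)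
        (u : borel X -> R) (v : borel Y -> R) : measurable_fun setT u ->
        measurable_fun setT v ->
        \int[(P \x Q)%E]_z (a z.1 * b z.2 * (t1 (u z.1) * t2 (v z.2))) =
        \int[P]_x (a x * t1 (u x)) * \int[Q]_y (b y * t2 (v y)).
      move=> mu' mv; under eq_Rintegral do rewrite mulrACA.
      rewrite (@integral_prod_tensor _ _ _ _ _ P Q (fun x => a x * t1 (u x))
        (fun y => b y * t2 (v y)))//; apply: bmfunM.
      - exact: cbfun_bmfun.
      - exact: bmfun_comp.
      - exact: cbfun_bmfun.
      - exact: bmfun_comp.
    rewrite H//; under eq_fun do rewrite H//.
    by apply: cvgM; [exact: approx_limit_integral|exact: approx_limit_integral].
  have bS := tensor_bmfun tS; have bS' := tensor_bmfun tS'.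
  have H (P : probability (borel X) R) (Q : probability (borel Y) R)
      (u : borel X -> R) (v : borel Y -> R) : measurable_fun setT u ->
      measurable_fun setT v ->
      \int[(P \x Q)%E]_z ((S z + S' z) * (t1 (u z.1) * t2 (v z.2))) =
      \int[(P \x Q)%E]_z (S z * (t1 (u z.1) * t2 (v z.2))) +
      \int[(P \x Q)%E]_z (S' z * (t1 (u z.1) * t2 (v z.2))).
    move=> mu' mv; under eq_Rintegral do rewrite mulrDl.
    by rewrite bmfun_integralD//; apply: bmfunM => //; exact: bfg.
  rewrite H//; under eq_fun do rewrite H//.
  exact: cvgD.
pose M := M1 * M2 + 1.
have M0 : 0 < M.
  rewrite ltr_wpDl// mulr_ge0//; first exact: le_trans (normr_ge0 _) (tM1 0).
  exact: le_trans (normr_ge0 _) (tM2 0).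
apply/cvgrPdist_le => e e0; have e3 : 0 < e / 3 by rewrite divr_gt0.
have eM : 0 < e / 3 / M by rewrite divr_gt0.
have [T tT [kT nkT]] :=
  continuous_tensor_approx polishX polishY UU mu_cvg nu_cvg ck k01 eM.
have bT := tensor_bmfun tT.
have bk : bmfun (k : (borel X * borel Y)%type -> R).
  split; first exact: continuous_prod_measurable.
  by exists 1 => z; have /andP[? ?] := k01 z; rewrite ger0_norm.
have H (P : probability (borel X) R) (Q : probability (borel Y) R)
    (u : borel X -> R) (v : borel Y -> R) : measurable_fun setT u ->
    measurable_fun setT v -> \int[(P \x Q)%E]_z `|k z - T z| <= e / 3 / M ->
    `|\int[(P \x Q)%E]_z (k z * (t1 (u z.1) * t2 (v z.2))) -
      \int[(P \x Q)%E]_z (T z * (t1 (u z.1) * t2 (v z.2)))| <= e / 3.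
  move=> mu' mv PQe.
  have bkT : bmfun (fun z : borel X * borel Y => `|k z - T z|).
    exact/bmfun_norm/bmfunB.
  apply: (@le_trans _ _ (\int[(P \x Q)%E]_z (M * `|k z - T z|))).
    apply: bmfun_integral_dist.
    - by apply: bmfunM => //; exact: bfg.
    - by apply: bmfunM => //; exact: bfg.
    - by apply: bmfunM => //; exact: bmfun_cst.
    move=> z; rewrite -mulrBl normrM mulrC ler_wpM2r// normrM.
    by rewrite (@le_trans _ _ (M1 * M2))// ?ler_pM// lerDl.
  by rewrite bmfun_integralZl// -ler_pdivlMl// mulrC.
have /cvgrPdist_le/(_ _ e3) := tensor_case _ tT.
apply: filterS2 nkT => n nkT Hn.
have H1 := H mu nu f g mf mg kT.
have H2 := H _ _ _ _ (mf_ n) (mg_ n) nkT.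
exact: ler_dist3 H1 H2 Hn.
Qed.

End joint_limit.

Section lipschitz_truncations.
Context {R : realType}.
Implicit Types (M t : R).

(** The quotient of [exp_cap M t] by [exp t]: the factor in [0, 1] by which the density shrinks when
    a potential is capped. *)
Definition cap_ratio M t : R := expR (Num.min t M - t).

(** A bounded Lipschitz substitute for the positive part, whose integral therefore passes to the
    limit. *)
Definition clamp M t : R := Num.min (Num.max t 0) M.

Lemma cap_ratio_itv M t : 0 <= cap_ratio M t <= 1.
Proof. by rewrite expR_ge0 -expR0 ler_expR subr_le0 ge_min lexx. Qed.

Lemma cap_ratio_ge M t : le_ind M t <= cap_ratio M t.
Proof.
rewrite le_indE; have [tM|_] := leP t M; last exact: expR_ge0.
by rewrite /cap_ratio min_l// subrr expR0.
Qed.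

Lemma bmfun_cap_ratio M : bmfun (cap_ratio M).
Proof.
split; last by exists 1 => t; have /andP[? ?] := cap_ratio_itv M t; rewrite ger0_norm.
apply: measurableT_comp; first exact: measurable_expR.
by apply: measurable_funB => //; apply: measurable_minr => //; exact: measurable_cst.
Qed.

Lemma cap_ratioM M t : cap_ratio M t * expR t = exp_cap M t.
Proof. by rewrite /cap_ratio -expRD subrK. Qed.

Lemma min_lipschitz M r s : `|Num.min r M - Num.min s M| <= `|r - s|.
Proof.
case: (leP r M) => rM; case: (leP s M) => sM; rewrite ?subrr ?normr0//.
  by rewrite !ler0_norm; lra.
by rewrite !ger0_norm; lra.
Qed.

Lemma exp_cap_lipschitz M : dist1_lipschitz (exp_cap M).
Proof.
have H (a b : R) : a <= b -> b <= M -> `|expR a - expR b| <= expR M * `|a - b|.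
  move=> ab bM; rewrite !ler0_norm ?subr_le0 ?ler_expR// !opprB.
  have -> : expR b - expR a = expR b * (1 - expR (a - b)).
    by rewrite mulrBr mulr1 -expRD [b + _]addrC subrK.
  have := expR_ge1Dx (a - b); have := expR_gt0 (a - b).
  have : expR b <= expR M by rewrite ler_expR.
  have := expR_gt0 b; move: (expR b) (expR M) (expR (a - b)) => u v w *.
  have u1 : u * (1 - w) <= u * (b - a) by rewrite ler_wpM2l//; lra.
  have v1 : u * (b - a) <= v * (b - a) by rewrite ler_wpM2r//; lra.
  exact: le_trans v1.
apply: (@dist1_lipschitzP _ _ (expR M) (expR M)) => [t|r s].
  by rewrite ger0_norm ?exp_cap_ge0 ?exp_cap_le.
have mM x : Num.min x M <= M by rewrite ge_min lexx orbT.
apply: (@le_trans _ _ (expR M * `|Num.min r M - Num.min s M|)).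
  rewrite /exp_cap; have [rs|sr] := leP (Num.min r M) (Num.min s M).
    exact: H.
  by rewrite distrC (distrC (Num.min r M)); apply: H => //; exact: ltW.
by rewrite ler_wpM2l ?expR_ge0// min_lipschitz.
Qed.

Lemma clamp_itv M t : 0 <= M -> 0 <= clamp M t <= M.
Proof. by move=> M0; rewrite le_min le_max lexx orbT M0 ge_min lexx orbT. Qed.

Lemma clamp_lipschitz M : 0 <= M -> dist1_lipschitz (clamp M).
Proof.
move=> M0; apply: (@dist1_lipschitzP _ _ M 1) => [t|r s].
  by have /andP[? ?] := clamp_itv t M0; rewrite ger0_norm.
rewrite mul1r /clamp (le_trans (min_lipschitz _ _ _))//.
have maxE (x : R) : Num.max x 0 = - Num.min (- x) 0.
  by rewrite oppr_min opprK oppr0.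
by rewrite !maxE -opprD normrN -(normrN (r - s)) opprD min_lipschitz.
Qed.

(** Markov's inequality before integration. *)
Lemma tail_le_clamp M t : 0 < M -> 1 - le_ind M t <= M^-1 * clamp M t.
Proof.
move=> M0; rewrite le_indE; have [tM|Mt] := leP t M.
  rewrite subrr mulr_ge0 ?invr_ge0 ?(ltW M0)//.
  by have /andP[] := clamp_itv t (ltW M0).
rewrite /clamp max_l ?(ltW (lt_trans M0 Mt))// min_r ?(ltW Mt)//.
by rewrite mulVf ?subr0// gt_eqF.
Qed.

End lipschitz_truncations.

(** * Cost of truncating the density of a Gibbs coupling *)

Section gibbs_truncation.
Context {R : realType} {X Y : ptopologicalType}.
Variables (c : X * Y -> R).
Variables (mu : probability (borel X) R) (nu : probability (borel Y) R).
Variables (f : X -> R) (g : Y -> R).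
Variable p : probability (borel X * borel Y)%type R.
Hypothesis fgp : gibbs_coupling c mu nu f g p.

(** Integrating [t * b] against the density is integrating it under [p], so the error is at most the
    [p]-integral of [1 - b]. The bound on [1 - b] splits into functions of one coordinate, whose
    integrals depend on the marginals only. *)
Lemma gibbs_truncation (t b : (borel X * borel Y)%type -> R) (M : R) :
  bmfun t -> bmfun b -> (forall z, `|t z| <= 1) -> (forall z, b z <= 1) ->
  (forall z, 1 - b z <= (1 - le_ind M (f z.1)) + (1 - le_ind M (g z.2))) ->
  `|\int[(mu \x nu)%E]_z (t z * b z * expR (oplus f g z - c z)) -
    \int[p]_z t z| <=
  \int[mu]_x (1 - le_ind M (f x)) + \int[nu]_y (1 - le_ind M (g y)).
Proof.
move=> bt bb t1 b1 bM; have [mf mg cp dp] := fgp.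
have btb : bmfun (fun z => t z * b z) by exact: bmfunM.
have [_ <-] := is_density_integral dp btb.
have b_1 d (T : measurableType d) := @bmfun_cst d T R 1.
have bf : bmfun (fun x : borel X => 1 - le_ind M (f x)).
  by apply: bmfunB => //; apply: bmfun_comp => //; exact: bmfun_le_ind.
have bg : bmfun (fun y : borel Y => 1 - le_ind M (g y)).
  by apply: bmfunB => //; apply: bmfun_comp => //; exact: bmfun_le_ind.
have bf' := bmfun_fst (borel Y) bf; have bg' := bmfun_snd (borel X) bg.
rewrite -(coupling_integral_fst cp bf) -(coupling_integral_snd cp bg).
rewrite -bmfun_integralD//; apply: bmfun_integral_dist => //; first exact: bmfunD.
move=> z; apply: le_trans (bM z).
rewrite -{2}[t z]mulr1 -mulrBr normrM distrC (@ger0_norm _ (1 - b z)) ?subr_ge0//.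
by rewrite ler_piMl ?subr_ge0.
Qed.

Lemma gibbs_truncation_l (s : borel X -> R) (M N : R) : bmfun s ->
  (forall x, `|s x| <= 1) ->
  `|\int[(mu \x nu)%E]_z
       (s z.1 * exp_trunc N (f z.1) * exp_cap M (g z.2) * expR (- c z))
    - \int[mu]_x (s x * le_ind N (f x))| <=
  \int[mu]_x (1 - le_ind M (f x)) + \int[nu]_y (1 - le_ind M (g y)).
Proof.
move=> bs s1; have [mf mg cp dp] := fgp.
have bsf : bmfun (fun x : borel X => s x * le_ind N (f x)).
  by apply: bmfunM => //; apply: bmfun_comp => //; exact: bmfun_le_ind.
rewrite -(coupling_integral_fst cp bsf).
(* The cutoff in [f] is put into the test function; only the cap on [g] counts as a truncation
   [b]. *)
have -> : \int[(mu \x nu)%E]_z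
    (s z.1 * exp_trunc N (f z.1) * exp_cap M (g z.2) * expR (- c z)) =
  \int[(mu \x nu)%E]_z ((s z.1 * le_ind N (f z.1)) * cap_ratio M (g z.2) *
    expR (oplus f g z - c z)).
  apply: eq_Rintegral => z _; rewrite /oplus !expRD /exp_trunc -cap_ratioM.
  by ring.
apply: gibbs_truncation.
- exact: (bmfun_fst (borel Y) bsf).
- exact: (bmfun_snd (borel X) (bmfun_comp (bmfun_cap_ratio M) mg)).
- move=> z; rewrite normrM -[leRHS]mul1r ler_pM// le_indE normr_nat.
  by rewrite lern1 leq_b1.
- by move=> z; have /andP[] := cap_ratio_itv M (g z.2).
- move=> z; rewrite (@le_trans _ _ (1 - le_ind M (g z.2)))//.
    by rewrite lerB// cap_ratio_ge.
  by rewrite lerDr le_indE subr_ge0 lern1 leq_b1.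
Qed.

Lemma gibbs_truncation_r (s : borel Y -> R) (M N : R) : bmfun s ->
  (forall x, `|s x| <= 1) ->
  `|\int[(mu \x nu)%E]_z
       (s z.2 * exp_trunc N (g z.2) * exp_cap M (f z.1) * expR (- c z))
    - \int[nu]_y (s y * le_ind N (g y))| <=
  \int[mu]_x (1 - le_ind M (f x)) + \int[nu]_y (1 - le_ind M (g y)).
Proof.
move=> bs s1; have [mf mg cp dp] := fgp.
have bsg : bmfun (fun y : borel Y => s y * le_ind N (g y)).
  by apply: bmfunM => //; apply: bmfun_comp => //; exact: bmfun_le_ind.
rewrite -(coupling_integral_snd cp bsg).
have -> : \int[(mu \x nu)%E]_z
    (s z.2 * exp_trunc N (g z.2) * exp_cap M (f z.1) * expR (- c z)) =
  \int[(mu \x nu)%E]_z ((s z.2 * le_ind N (g z.2)) * cap_ratio M (f z.1) *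
    expR (oplus f g z - c z)).
  apply: eq_Rintegral => z _; rewrite /oplus !expRD /exp_trunc -cap_ratioM.
  by ring.
apply: gibbs_truncation.
- exact: (bmfun_snd (borel X) bsg).
- exact: (bmfun_fst (borel Y) (bmfun_comp (bmfun_cap_ratio M) mf)).
- move=> z; rewrite normrM -[leRHS]mul1r ler_pM// le_indE normr_nat.
  by rewrite lern1 leq_b1.
- by move=> z; have /andP[] := cap_ratio_itv M (f z.1).
- move=> z; rewrite (@le_trans _ _ (1 - le_ind M (f z.1)))//.
    by rewrite lerB// cap_ratio_ge.
  by rewrite lerDl le_indE subr_ge0 lern1 leq_b1.
Qed.

(** Here [b] is a product of two ratios in [0, 1], and [1 - a * b <= (1 - a) + (1 - b)]. *)
Lemma gibbs_truncation_both (t : (borel X * borel Y)%type -> R) (M : R) :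
  bmfun t -> (forall z, `|t z| <= 1) ->
  `|\int[(mu \x nu)%E]_z
       (t z * expR (- c z) * (exp_cap M (f z.1) * exp_cap M (g z.2)))
    - \int[p]_z t z| <=
  \int[mu]_x (1 - le_ind M (f x)) + \int[nu]_y (1 - le_ind M (g y)).
Proof.
move=> bt t1; have [mf mg cp dp] := fgp.
have -> : \int[(mu \x nu)%E]_z
    (t z * expR (- c z) * (exp_cap M (f z.1) * exp_cap M (g z.2))) =
  \int[(mu \x nu)%E]_z (t z * (cap_ratio M (f z.1) * cap_ratio M (g z.2)) *
    expR (oplus f g z - c z)).
  apply: eq_Rintegral => z _; rewrite /oplus !expRD -!cap_ratioM.
  by ring.
apply: gibbs_truncation => //.
- apply: bmfunM.
    exact: (bmfun_fst (borel Y) (bmfun_comp (bmfun_cap_ratio M) mf)).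
  exact: (bmfun_snd (borel X) (bmfun_comp (bmfun_cap_ratio M) mg)).
- move=> z; have /andP[? ?] := cap_ratio_itv M (f z.1).
  by have /andP[? ?] := cap_ratio_itv M (g z.2); rewrite mulr_ile1.
- move=> z; have := cap_ratio_itv M (f z.1); have := cap_ratio_itv M (g z.2).
  have := cap_ratio_ge M (f z.1); have := cap_ratio_ge M (g z.2).
  move: (cap_ratio M _) (cap_ratio M _) (le_ind M _) (le_ind M _) => a b u v.
  by move=> ? ? /andP[? ?] /andP[? ?]; nra.
Qed.

End gibbs_truncation.

(** * Passage to the limit in Gibbs couplings *)

Section gibbs_limit.
Context {R : realType} {X Y : ptopologicalType}.
Hypotheses (polishX : polish R X) (polishY : polish R Y).
Variable (c : X * Y -> R).
Hypotheses (cc : continuous c) (c0 : forall z, 0 <= c z).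
Variable (U : set_system nat).
Hypothesis (UU : UltraFilter U).
Variables (mu_ : nat -> probability (borel X) R) (mu : probability (borel X) R).
Variables (nu_ : nat -> probability (borel Y) R) (nu : probability (borel Y) R).
Hypotheses (mu_cvg : wcvg_along U mu_ mu) (nu_cvg : wcvg_along U nu_ nu).
Variables (f_ : nat -> X -> R) (g_ : nat -> Y -> R).
Variable p_ : nat -> probability (borel X * borel Y)%type R.
Hypothesis fgp : forall n, gibbs_coupling c (mu_ n) (nu_ n) (f_ n) (g_ n) (p_ n).
Variable K : R.
Hypothesis f_K : forall n (M : R), 0 < M -> \int[mu_ n]_x clamp M (f_ n x) <= K.
Hypothesis g_K : forall n (M : R), 0 < M -> \int[nu_ n]_y clamp M (g_ n y) <= K.

Let PU : ProperFilter U := @ultra_proper _ _ UU.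

Let mf_ n : measurable_fun [set: borel X] (f_ n).
Proof. by have [] := fgp n. Qed.

Let mg_ n : measurable_fun [set: borel Y] (g_ n).
Proof. by have [] := fgp n. Qed.

Let K0 : 0 <= K.
Proof.
apply: le_trans (f_K 0%N ltr01); apply: Rintegral_ge0 => x _.
by have /andP[] := clamp_itv (f_ 0%N x) ler01.
Qed.

Let tail d (T : measurableType d) (P : probability T R) (h : T -> R) (M : R) :
  measurable_fun setT h -> 0 < M -> \int[P]_x clamp M (h x) <= K ->
  \int[P]_x (1 - le_ind M (h x)) <= K / M.
Proof.
move=> mh M0 hK.
have bc : bmfun (fun x => clamp M (h x)).
  apply: bmfun_comp => //; apply: dist1_lipschitz_bmfun.
  by apply: clamp_lipschitz; exact: ltW.
apply: (@le_trans _ _ (\int[P]_x (M^-1 * clamp M (h x)))).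
  apply: le_bmfun_integral.
  - by apply: bmfunB; [exact: bmfun_cst|exact: (bmfun_comp (bmfun_le_ind M) mh)].
  - by apply: bmfunM => //; exact: bmfun_cst.
  - by move=> x; exact: tail_le_clamp.
by rewrite bmfun_integralZl// mulrC ler_wpM2r// invr_ge0 ltW.
Qed.

Let tails n (M : R) : 0 < M ->
  \int[mu_ n]_x (1 - le_ind M (f_ n x)) + \int[nu_ n]_y (1 - le_ind M (g_ n y))
    <= 2 * K / M.
Proof.
move=> M0; have := tail (mf_ n) M0 (f_K n M0); have := tail (mg_ n) M0 (g_K n M0).
by rewrite -mulrA; move: (K / M) (\int[_]_x _) (\int[_]_x _) => u v w; lra.
Qed.

Let ck : continuous (fun z => expR (- c z)).
Proof.
move=> z; apply: continuous_comp; last exact: continuous_expR.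
by apply: cvgN; exact: cc.
Qed.

Let k01 z : 0 <= expR (- c z) <= 1.
Proof. by rewrite expR_ge0 -expR0 ler_expR oppr_le0 c0. Qed.

Lemma potential_limit_l : exists f, approx_limit U mu_ mu f_ f.
Proof.
apply: approx_limit_exists => // e e0.
apply: (potential_approx polishX polishY UU mu_cvg nu_cvg (K := 2 * K) ck k01
  mf_ mg_) => // [n M M0|n M N s M0 bs s1].
  rewrite (le_trans (tail (mf_ n) M0 (f_K n M0)))// ler_wpM2r ?invr_ge0 ?(ltW M0)//.
  by rewrite ler_peMl// ler1n.
exact: le_trans (gibbs_truncation_l (fgp n) _ _ bs s1) (tails n M0).
Qed.

Lemma potential_limit_r : exists g, approx_limit U nu_ nu g_ g.
Proof.
apply: approx_limit_exists => // e e0.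
(* The one-sided approximation is reused with the coordinates exchanged; [integral_prod_swap]
   returns to the original order. *)
pose k (z : Y * X) := expR (- c (z.2, z.1)).
have ck' : continuous k.
  move=> z; apply: (@continuous_comp _ _ _ (fun z : Y * X => (z.2, z.1))
    (fun z => expR (- c z))); last exact: ck.
  by apply: cvg_pair; [exact: cvg_snd|exact: cvg_fst].
apply: (potential_approx polishY polishX UU nu_cvg mu_cvg (K := 2 * K) ck' _
  mg_ mf_) => // [z|n M M0|n M N s M0 bs s1].
- exact: k01.
- rewrite (le_trans (tail (mg_ n) M0 (g_K n M0)))// ler_wpM2r ?invr_ge0 ?(ltW M0)//.
  by rewrite ler_peMl// ler1n.
have bs2 := bmfun_snd (borel X) bs.
have bg2 := bmfun_snd (borel X) (bmfun_comp (bmfun_exp_trunc N) (mg_ n)).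
have bf1 := bmfun_fst (borel Y) (bmfun_comp (bmfun_exp_cap M) (mf_ n)).
have bk : bmfun (fun z : borel X * borel Y => expR (- c z)).
  split; first exact: (continuous_prod_measurable polishX polishY ck).
  by exists 1 => z; have /andP[? ?] := k01 z; rewrite ger0_norm.
rewrite (@integral_prod_swap _ _ _ _ _ (mu_ n) (nu_ n) (fun z : borel X * borel Y =>
  s z.2 * exp_trunc N (g_ n z.2) * exp_cap M (f_ n z.1) * expR (- c z))); last first.
  by apply: bmfunM => //; apply: bmfunM => //; exact: bmfunM.
exact: le_trans (gibbs_truncation_r (fgp n) _ _ bs s1) (tails n M0).
Qed.

Variables (f : X -> R) (g : Y -> R).
Hypothesis fP : approx_limit U mu_ mu f_ f.
Hypothesis gP : approx_limit U nu_ nu g_ g.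

Lemma clamp_limit_l (M : R) : 0 < M -> \int[mu]_x clamp M (f x) <= K.
Proof.
move=> M0; have cM := clamp_lipschitz (ltW M0).
have := approx_limit_integral PU mu_cvg mf_ fP (cbfun_cst 1) cM.
under eq_fun do under eq_Rintegral do rewrite mul1r.
under eq_Rintegral do rewrite mul1r.
move=> H; apply: le_trans (ler_norm _) _.
have H' := @cvg_norm_bound R U _ _ K _ H; apply: H' => e e0.
apply: nearW => n; rewrite ger0_norm; last first.
  by apply: Rintegral_ge0 => x _; have /andP[] := clamp_itv (f_ n x) (ltW M0).
by rewrite (le_trans (f_K n M0))// lerDl ltW.
Qed.

Lemma clamp_limit_r (M : R) : 0 < M -> \int[nu]_y clamp M (g y) <= K.
Proof.
move=> M0; have cM := clamp_lipschitz (ltW M0).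
have := approx_limit_integral PU nu_cvg mg_ gP (cbfun_cst 1) cM.
under eq_fun do under eq_Rintegral do rewrite mul1r.
under eq_Rintegral do rewrite mul1r.
move=> H; apply: le_trans (ler_norm _) _.
have H' := @cvg_norm_bound R U _ _ K _ H; apply: H' => e e0.
apply: nearW => n; rewrite ger0_norm; last first.
  by apply: Rintegral_ge0 => x _; have /andP[] := clamp_itv (g_ n x) (ltW M0).
by rewrite (le_trans (g_K n M0))// lerDl ltW.
Qed.

Let q z := expR (oplus f g z - c z).

Let mf : measurable_fun [set: borel X] f. Proof. exact: fP.1. Qed.

Let mg : measurable_fun [set: borel Y] g. Proof. exact: gP.1. Qed.

Let mq : measurable_fun [set: (borel X * borel Y)%type] q.
Proof.
apply: measurableT_comp => //; apply: measurable_funB.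
  exact: measurable_oplus.
exact: continuous_prod_measurable.
Qed.

(** For fixed [M] the capped integrals converge along [U], and they differ from those of [t] under
    [p_ n] by at most [2 * K / M], uniformly in [n]. Letting [M] increase, monotone convergence
    gives the exact value and thereby the integrability of [t * q]. *)
Lemma limit_identity (t : X * Y -> R) (a_ : nat -> R) (a : R) :
  continuous t -> (forall z, 0 <= t z <= 1) ->
  (forall n, a_ n = \int[p_ n]_z t z) -> a_ @ U --> a ->
  (\int[(mu \x nu)%E]_z (t z * q z)%:E = a%:E)%E.
Proof.
move=> ct t01 aE a_a.
have ctk : continuous (fun z => t z * expR (- c z)).
  by move=> z; apply: cvgM; [exact: ct|exact: ck].
have tk01 z : 0 <= t z * expR (- c z) <= 1.
  by have /andP[? ?] := t01 z; have /andP[? ?] := k01 z; rewrite mulr_ge0// mulr_ile1.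
have bt : bmfun (t : (borel X * borel Y)%type -> R).
  split; first exact: (continuous_prod_measurable polishX polishY ct).
  by exists 1 => z; have /andP[? ?] := t01 z; rewrite ger0_norm.
have btk : bmfun (fun z : borel X * borel Y => t z * expR (- c z)).
  split; first exact: (continuous_prod_measurable polishX polishY ctk).
  by exists 1 => z; have /andP[? ?] := tk01 z; rewrite ger0_norm.
pose F (M : R) (z : borel X * borel Y) : R := t z * expR (- c z) *
  (exp_cap M (f z.1) * exp_cap M (g z.2)).
have bF M : bmfun (F M).
  apply: bmfunM => //; apply: bmfunM.
    exact: (bmfun_fst (borel Y) (bmfun_comp (bmfun_exp_cap M) mf)).
  exact: (bmfun_snd (borel X) (bmfun_comp (bmfun_exp_cap M) mg)).
have F_a (M : R) : 0 < M -> `|\int[(mu \x nu)%E]_z F M z - a| <= 2 * K / M.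
  move=> M0; have lM := exp_cap_lipschitz M.
  have H := joint_limit_integral polishX polishY UU mu_cvg nu_cvg mf_ mg_ fP gP
    ctk tk01 lM lM.
  have H1 : (fun n => \int[(mu_ n \x nu_ n)%E]_z (t z * expR (- c z) *
      (exp_cap M (f_ n z.1) * exp_cap M (g_ n z.2))) - \int[p_ n]_z t z) @ U -->
      \int[(mu \x nu)%E]_z F M z - a.
    by apply: cvgB => //; under eq_fun do rewrite -aE.
  have H' := @cvg_norm_bound R U _ _ (2 * K / M) _ H1; apply: H' => e e0.
  apply: nearW => n.
  apply: le_trans (gibbs_truncation_both (fgp n) M bt _) _.
    by move=> z; have /andP[? ?] := t01 z; rewrite ger0_norm.
  by rewrite (le_trans (tails n M0))// lerDl ltW.
have Fcvg : (fun m : nat => \int[(mu \x nu)%E]_z F m.+1%:R z) @ \oo --> a.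
  apply/cvgrPdist_le => e e0; near=> m; rewrite distrC.
  apply: le_trans (F_a _ (ltr0Sn _ _)) _.
  rewrite ler_pdivrMr// [e * _]mulrC -ler_pdivrMr//.
  rewrite (@le_trans _ _ m%:R) ?ler_nat//.
  by near: m; exact: nbhs_infty_ger.
have q_lim z : (t z * q z)%:E = limn (fun m : nat => (F m.+1%:R z)%:E).
  apply/esym/cvg_lim => //; apply: cvg_near_cst; near=> m; congr EFin.
  rewrite /F /q /oplus /exp_cap !min_l.
  - by rewrite !expRD; ring.
  - rewrite (@le_trans _ _ m%:R) ?ler_nat//.
    by near: m; exact: nbhs_infty_ger.
  - rewrite (@le_trans _ _ m%:R) ?ler_nat//.
    by near: m; exact: nbhs_infty_ger.
under eq_integral do rewrite q_lim.
rewrite monotone_convergence//.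
- under eq_fun do rewrite bmfun_integralE//.
  by apply/cvg_lim => //; apply: cvg_EFin => //; exact: nearW.
- by move=> m; apply/measurable_EFinP; have [] := bF m.+1%:R.
- move=> m z _; rewrite lee_fin; apply: mulr_ge0; first by have /andP[] := tk01 z.
  by rewrite mulr_ge0// exp_cap_ge0.
- move=> z _ m n mn; rewrite lee_fin ler_wpM2l//; first by have /andP[] := tk01 z.
  have capS r : exp_cap m.+1%:R r <= exp_cap n.+1%:R r :> R.
    by rewrite ler_expR le_min !ge_min lexx/= ler_nat ltnS mn orbT.
  by rewrite ler_pM// exp_cap_ge0.
Unshelve. all: by end_near. Qed.

(** In [limit_identity], [t = 1] gives total mass 1, and functions of one coordinate give the
    marginals, since their integrals under [p_ n] are integrals under [mu_ n] or [nu_ n]. *)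
Lemma limit_gibbs_coupling : exists p, gibbs_coupling c mu nu f g p.
Proof.
have q0 z : 0 <= q z by exact: expR_ge0.
have q1 : (\int[(mu \x nu)%E]_z (q z)%:E = 1)%E.
  rewrite -(@limit_identity (fun=> 1) (fun=> 1) 1).
  - by apply: eq_integral => z _; rewrite mul1r.
  - by move=> z; exact: cvg_cst.
  - by move=> z; rewrite ler01 lexx.
  - by move=> n; rewrite prob_integral_cst.
  - exact: cvg_cst.
have [p dp] := density_probability_exists mq q0 q1.
exists p; split => //.
have [mfst msnd] : measurable_fun [set: (borel X * borel Y)%type] fst /\
    measurable_fun [set: (borel X * borel Y)%type] snd by [].
have marg (t : X * Y -> R) (a_ : nat -> R) (a : R) : continuous t ->
    (forall z, 0 <= t z <= 1) -> (forall n, a_ n = \int[p_ n]_z t z) ->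
    a_ @ U --> a -> \int[p]_z t z = a.
  move=> ct t01 aE a_a; have := limit_identity ct t01 aE a_a.
  have bt : bmfun (t : (borel X * borel Y)%type -> R).
    split; first exact: (continuous_prod_measurable polishX polishY ct).
    by exists 1 => z; have /andP[? ?] := t01 z; rewrite ger0_norm.
  have [_ ->] := is_density_integral dp bt.
  by rewrite /Rintegral => ->.
split=> A mA.
- pose p1 : probability (borel X) R := distribution p (mfun_Sub (mem_set mfst)).
  rewrite -[LHS]/(p1 A); apply: (borel_probability_eq polishX) => // h bh h01.
  have bh' := cbfun_bmfun bh; have [mh _] := bh'.
  transitivity (\int[p]_z h z.1).
    rewrite /Rintegral; congr fine; rewrite integral_distribution//.
      exact/measurable_EFinP.
    exact: bmfun_integrable (bmfun_fst (borel Y) bh').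
  apply: (marg (fun z => h z.1) (fun n => \int[mu_ n]_x h x)).
  - move=> z; apply: (@continuous_comp _ _ _ fst h); first exact: cvg_fst.
    exact: bh.1.
  - by move=> z; exact: h01.
  - by move=> n; have [_ _ cp _] := fgp n; rewrite (coupling_integral_fst cp bh').
  - exact: mu_cvg.
- pose p2 : probability (borel Y) R := distribution p (mfun_Sub (mem_set msnd)).
  rewrite -[LHS]/(p2 A); apply: (borel_probability_eq polishY) => // h bh h01.
  have bh' := cbfun_bmfun bh; have [mh _] := bh'.
  transitivity (\int[p]_z h z.2).
    rewrite /Rintegral; congr fine; rewrite integral_distribution//.
      exact/measurable_EFinP.
    exact: bmfun_integrable (bmfun_snd (borel X) bh').
  apply: (marg (fun z => h z.2) (fun n => \int[nu_ n]_y h y)).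
  - move=> z; apply: (@continuous_comp _ _ _ snd h); first exact: cvg_snd.
    exact: bh.1.
  - by move=> z; exact: h01.
  - by move=> n; have [_ _ cp _] := fgp n; rewrite (coupling_integral_snd cp bh').
  - exact: nu_cvg.
Qed.

End gibbs_limit.

(** * Convergence in probability *)

Section convergence_in_probability.
Context d (T : measurableType d) (R : realType).
Implicit Types (P Q : probability T R) (u : T -> R).

Lemma measurable_norm_gt u (e : R) : measurable_fun setT u ->
  measurable [set x | e < `|u x|].
Proof.
move=> mu; rewrite (_ : [set x | _] = (fun x => `|u x|) @^-1` `]e, +oo[); last first.
  by apply/seteqP; split => x /=; rewrite in_itv/= andbT.
by rewrite -[X in measurable X]setTI; apply: measurableT_comp => //; exact: measurable_itv.
Qed.

Lemma prob_integral_indic P (A : set T) : measurable A ->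
  P A = (\int[P]_x \1_A x)%:E.
Proof.
move=> mA; rewrite /Rintegral integral_indic// setIT fineK//.
exact: fin_num_measure.
Qed.

Lemma prob_norm_gt_le P u (e : R) : measurable_fun setT u -> 0 < e ->
  (P [set x | (e < `|u x|)%R] <= (\int[P]_x Num.min 1 `|u x| / Num.min 1 e)%:E)%E.
Proof.
move=> mu e0; have r0 : 0 < Num.min 1 e by rewrite lt_min ltr01.
have mA := measurable_norm_gt e mu; have bu := bmfun_dist1 mu.
rewrite prob_integral_indic// lee_fin ler_pdivlMr// mulrC -bmfun_integralZl//; last first.
  split; first exact: measurable_indic.
  by exists 1 => x; rewrite indicE normr_nat lern1 leq_b1.
apply: le_bmfun_integral => //.
  apply: bmfunM; first exact: bmfun_cst.
  split; first exact: measurable_indic.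
  by exists 1 => x; rewrite indicE normr_nat lern1 leq_b1.
move=> x; rewrite indicE; have [/set_mem/= eu|_] := boolP (x \in _).
  by rewrite mulr1 le_min !ge_min lexx/= (ltW eu) orbT.
by rewrite mulr0 le_min ler01 normr_ge0.
Qed.

Lemma prob_dist_gt_split P (u v w : T -> R) (e : R) : measurable_fun setT u ->
  measurable_fun setT v -> measurable_fun setT w ->
  (P [set x | (e < `|u x - w x|)%R] <=
   P [set x | (e / 2 < `|u x - v x|)%R] + P [set x | (e / 2 < `|v x - w x|)%R])%E.
Proof.
move=> mu mv mw.
have m1 := measurable_norm_gt (e / 2) (measurable_funB mu mv).
have m2 := measurable_norm_gt (e / 2) (measurable_funB mv mw).
have m3 := measurable_norm_gt e (measurable_funB mu mw).
apply: le_trans (measureU2 P m1 m2); apply: le_measure; rewrite ?inE//.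
  exact: measurableU.
move=> x /= ex; have [H|H] := ltP (e / 2) `|u x - v x|; first by left.
right; have := ler_distD (v x) (u x) (w x); lra.
Qed.

Lemma cvg_prob0 P (U : set_system nat) (A_ : nat -> set T) : Filter U ->
  (forall n, measurable (A_ n)) ->
  (forall e : R, 0 < e -> \forall n \near U, (P (A_ n) <= e%:E)%E) ->
  (fun n => P (A_ n)) @ U --> 0%E.
Proof.
move=> FU mA H; have fin n : P (A_ n) \is a fin_num by exact: fin_num_measure.
apply: cvg_EFin; first exact: nearW.
apply/cvgrPdist_le => e e0; apply: filterS (H e e0) => n Hn.
by rewrite sub0r normrN ger0_norm ?fine_ge0//= -lee_fin fineK.
Qed.

Lemma cvg_prob0P P (U : set_system nat) (A_ : nat -> set T) : ProperFilter U ->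
  (forall n, measurable (A_ n)) -> (fun n => P (A_ n)) @ U --> 0%E ->
  forall e : R, 0 < e -> \forall n \near U, (P (A_ n) <= e%:E)%E.
Proof.
move=> FU mA /fine_cvg/cvgrPdist_le H e e0; apply: filterS (H e e0) => n /=.
rewrite sub0r normrN => /(le_trans (ler_norm _)).
by rewrite -lee_fin fineK//; exact: fin_num_measure.
Qed.

(** [A] is split according to whether the density reaches the level [C]. *)
Lemma density_prob_le P Q (A : set T) (C : R) : P `<< Q -> 0 < C ->
  measurable A ->
  (P A <= C%:E * Q A + P [set x | (C%:E <= density P Q x)%E])%E.
Proof.
move=> PQ C0 mA.
have iD : Q.-integrable setT (density P Q) by exact: Radon_Nikodym_integrable.
have mD : measurable_fun setT (density P Q) := measurable_int _ iD.
have mB : measurable [set x | (C%:E <= density P Q x)%E].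
  rewrite -[X in measurable X]setTI.
  exact: emeasurable_fun_c_infty.
set B := [set x | _] in mB *.
have mAB : measurable (A `\` B) by exact: measurableD.
apply: (@le_trans _ _ (P (A `\` B) + P B)%E).
  apply: le_trans (measureU2 P mAB mB); apply: le_measure; rewrite ?inE//.
    exact: measurableU.
  by move=> x Ax; have [Bx|Bx] := pselect (B x); [right|left].
apply: leeD => //.
rewrite [leLHS](@Radon_Nikodym_integral _ _ _ (charge_of_finite_measure P) Q _ PQ mAB).
apply: (@le_trans _ _ (\int[Q]_(x in A `\` B) (cst C%:E x))%E).
  apply: le_integral => //.
  - exact: integrableS iD.
  - by apply: finite_measure_integrable_cst.
  - by move=> x /set_mem[_ /negP]; rewrite -ltNge => /ltW.
rewrite integral_cst//; apply: lee_wpmul2l; first by rewrite lee_fin ltW.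
by apply: le_measure; rewrite ?inE//; exact: subDsetl.
Qed.

(** A form of contiguity of [P] with respect to [P_ n], uniform in the event: a level [C] leaves
    less than [e / 2] in the tail, and below that level [P] is at most [C] times [P_ n]. *)
Lemma contiguous_of_tail P (P_ : nat -> probability T R) :
  (forall n, P `<< P_ n) ->
  limf_esup (fun C : R => limn_esup (fun n =>
     P [set x | (C%:E <= density P (P_ n) x)%E])) (pinfty_nbhs R) = 0%E ->
  forall e : R, 0 < e -> exists2 r : R, 0 < r & \forall n \near \oo,
    forall A, measurable A -> (P_ n A <= r%:E)%E -> (P A <= e%:E)%E.
Proof.
move=> dom tail e e0; have e20 : 0 < e / 2 by rewrite divr_gt0.
have : (limf_esup (fun C : R => limn_esup (fun n =>
     P [set x | (C%:E <= density P (P_ n) x)%E])) (pinfty_nbhs R) < (e / 2)%:E)%E.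
  by rewrite tail lte_fin.
move=> /ereal_inf_lt[_ [V [M [_ MV]] <-] supV].
(* [V] contains every number strictly above [M]; the maximum with 0 makes [C] positive. *)
pose C := Num.max M 0 + 1.
have C0 : 0 < C by rewrite ltr_wpDl// le_max lexx orbT.
have VC : V C by apply: MV; rewrite ltr_pwDr// le_max lexx.
have : (limn_esup (fun n => P [set x | (C%:E <= density P (P_ n) x)%E]) < (e / 2)%:E)%E.
  by apply: le_lt_trans supV; apply: ereal_sup_ubound; exists C.
move=> /ereal_inf_lt[_ [W Woo <-] supW].
exists (e / 2 / C); first by rewrite divr_gt0.
apply: filterS Woo => n Wn A mA PnA.
apply: le_trans (density_prob_le (dom n) C0 mA) _.
rewrite (_ : e%:E = (e / 2)%:E + (e / 2)%:E)%E; last by rewrite -EFinD -splitr.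
apply: leeD.
  rewrite [leRHS](_ : _ = C%:E * (e / 2 / C)%:E)%E; last first.
    by rewrite -EFinM [C * _]mulrC divfK// gt_eqF.
  by rewrite lee_wpmul2l// lee_fin ltW.
by apply: le_trans (ltW supW); apply: ereal_sup_ubound; exists n.
Qed.

End convergence_in_probability.

(** [f_ n] is near [h p] in [mu_ n]-probability, hence in [mu]-probability by contiguity, and [h p]
    is near [f] in [mu]-probability. *)
Lemma approx_limit_prob {R : realType} {X : ptopologicalType}
    (U : set_system nat) (mu_ : nat -> probability (borel X) R)
    (mu : probability (borel X) R) (f_ : nat -> X -> R) (f : X -> R) (e : R) :
  ProperFilter U -> \oo `<=` U ->
  (forall n, measurable_fun [set: borel X] (f_ n)) ->
  approx_limit U mu_ mu f_ f ->
  (forall e : R, 0 < e -> exists2 r : R, 0 < r & \forall n \near \oo,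
    forall A : set (borel X), measurable A ->
    (mu_ n A <= r%:E)%E -> (mu A <= e%:E)%E) ->
  0 < e ->
  (fun n => mu [set x | e < `|f_ n x - f x|]) @ U --> 0%E.
Proof.
move=> PU ooU mf_ [mf [h [bh nh hf]]] cont e0.
have mh p : measurable_fun [set: borel X] (h p).
  by apply: continuous_borel_measurable; have [] := bh p.
apply: cvg_prob0 => [n|eta eta0].
  by apply: measurable_norm_gt; exact: measurable_funB.
have eta20 : 0 < eta / 2 by rewrite divr_gt0.
have e20 : 0 < e / 2 by rewrite divr_gt0.
have [r r0 rP] := cont _ eta20.
have s0 : 0 < Num.min 1 (e / 2) by rewrite lt_min ltr01.
have : (fun p => \int[mu]_x Num.min 1 `|h p x - f x|) @ \oo --> (0 : R).
  rewrite -[X in _ --> X](prob_integral_cst mu 0).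
  apply: (@ae_bmfun_dominated _ _ _ _ _ _ 1).
  - by move=> p; have [] := bmfun_dist1 (measurable_funB (mh p) mf).
  - exact: measurable_cst.
  - by move=> p x; rewrite ger0_norm ?ge_min ?lexx// le_min ler01 normr_ge0.
  - have [A [mA A0 sA]] := hf; exists A; split=> // x /= nx; apply: sA => /= hx.
    apply: nx; apply/cvgrPdist_le => d d0.
    have /cvgrPdist_le/(_ _ d0) := hx; apply: filterS => p hp.
    rewrite sub0r normrN ger0_norm ?le_min ?ler01 ?normr_ge0//.
    by rewrite ge_min distrC hp orbT.
(* Markov's inequality for the truncated distance divides by [Num.min 1 (e / 2)], which these
   thresholds compensate. *)
have d0 : 0 < eta / 2 * Num.min 1 (e / 2) by rewrite mulr_gt0.
have d1 : 0 < r * Num.min 1 (e / 2) by rewrite mulr_gt0.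
move=> /cvgrPdist_le/(_ _ d0) H1.
have : (fun p => 2^-1 ^+ p : R) @ \oo --> (0 : R).
  by apply: cvg_expr; rewrite ger0_norm ?invr_ge0// invf_lt1// ltr1n.
move=> /cvgrPdist_le/(_ _ d1) H2.
have [p [/= H3 H4]] := filter_ex (filterI H1 H2).
have near_h : \forall n \near U, forall A : set (borel X), measurable A ->
    (mu_ n A <= r%:E)%E -> (mu A <= (eta / 2)%:E)%E by exact: ooU.
apply: filterS2 near_h (nh p) => n Hn nhp.
apply: le_trans (prob_dist_gt_split mu e (mf_ n) (mh p) mf) _.
rewrite (_ : eta%:E = (eta / 2)%:E + (eta / 2)%:E)%E; last by rewrite -EFinD -splitr.
apply: leeD.
  apply: Hn; first by apply: measurable_norm_gt; exact: measurable_funB.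
  apply: le_trans (prob_norm_gt_le (mu_ n) (measurable_funB (mf_ n) (mh p)) e20) _.
  rewrite lee_fin ler_pdivrMr// (le_trans nhp)//.
  by move: H4; rewrite sub0r normrN; apply: le_trans; exact: ler_norm.
apply: le_trans (prob_norm_gt_le mu (measurable_funB (mh p) mf) e20) _.
rewrite lee_fin ler_pdivrMr//.
by move: H3; rewrite sub0r normrN; apply: le_trans; exact: ler_norm.
Qed.

Lemma measurable_lne_density d (T : measurableType d) (R : realType)
    (p P : probability T R) : p `<< P ->
  measurable_fun setT (fun z => lne (density p P z)).
Proof.
move=> pP; have iD : P.-integrable setT (density p P).
  exact: Radon_Nikodym_integrable.
have finD z : density p P z \is a fin_num by exact: Radon_Nikodym_fin_num.
rewrite (_ : (fun z => _) = fun z => if (fine (density p P z) <= 0)%R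
    then -oo%E else (ln (fine (density p P z)))%:E); last first.
  by apply/funext => z; rewrite -[in LHS](fineK (finD z)).
have mfD : measurable_fun setT (fun z => fine (density p P z)).
  by apply: measurableT_comp => //; exact: measurable_int iD.
apply: measurable_fun_ifT.
- by apply: measurable_fun_ler => //; exact: measurable_cst.
- exact: measurable_cst.
- by apply/measurable_EFinP; apply: measurableT_comp => //; exact: measurable_ln.
Qed.

Lemma min_add_le {R : realType} (a b n m : R) : 0 <= a -> 0 <= b -> 0 <= m ->
  n <= m -> Num.min (a + b) n <= Num.min a m + Num.min b m.
Proof.
move=> a0 b0 m0 nm; rewrite ge_min.
by case: (leP a m) => ?; case: (leP b m) => ?;
  apply/orP; ((left; lra) || (right; lra)).
Qed.

(** * Finiteness of the transport cost *)

Section finite_cost.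
Context {R : realType} {X Y : ptopologicalType}.
Variable c : X * Y -> R.
Hypothesis mc : measurable_fun [set: (borel X * borel Y)%type] c.
Hypothesis c0 : forall z, 0 <= c z.
Variables (mu : probability (borel X) R) (nu : probability (borel Y) R).
Variables (f : X -> R) (g : Y -> R).
Variable p : probability (borel X * borel Y)%type R.
Hypothesis fgp : gibbs_coupling c mu nu f g p.
Variable K : R.
Hypothesis f_K : forall M : R, 0 < M -> \int[mu]_x clamp M (f x) <= K.
Hypothesis g_K : forall M : R, 0 < M -> \int[nu]_y clamp M (g y) <= K.

Let u z := oplus f g z - c z.
Let v z := Num.max (f z.1) 0 + Num.max (g z.2) 0.

Let mf : measurable_fun [set: borel X] f. Proof. by have [] := fgp. Qed.
Let mg : measurable_fun [set: borel Y] g. Proof. by have [] := fgp. Qed.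

Let measurable_u : measurable_fun [set: (borel X * borel Y)%type] u.
Proof. by apply: measurable_funB => //; exact: measurable_oplus. Qed.

Let measurable_v : measurable_fun [set: (borel X * borel Y)%type] v.
Proof.
apply: (@measurable_oplus _ _ _ (borel X) (borel Y) (fun x => Num.max (f x) 0)
  (fun y => Num.max (g y) 0)).
- by apply: measurable_maxr => //; exact: measurable_cst.
- by apply: measurable_maxr => //; exact: measurable_cst.
Qed.

Let b z M := clamp M (f z.1) + clamp M (g z.2).

Let bb (M : R) : 0 < M -> bmfun (fun z : borel X * borel Y => b z M).
Proof.
move=> M0; have bM := dist1_lipschitz_bmfun (clamp_lipschitz (ltW M0)).
apply: bmfunD; first exact: (bmfun_fst (borel Y) (bmfun_comp bM mf)).
exact: (bmfun_snd (borel X) (bmfun_comp bM mg)).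
Qed.

Let b_K (M : R) : 0 < M -> \int[p]_z b z M <= 2 * K.
Proof.
move=> M0; have bM := dist1_lipschitz_bmfun (clamp_lipschitz (ltW M0)).
have [_ _ cp _] := fgp.
rewrite bmfun_integralD; last 2 first.
- exact: (bmfun_fst (borel Y) (bmfun_comp bM mf)).
- exact: (bmfun_snd (borel X) (bmfun_comp bM mg)).
rewrite (coupling_integral_fst cp (bmfun_comp bM mf)).
rewrite (coupling_integral_snd cp (bmfun_comp bM mg)).
by rewrite mulr2n mulrDl mul1r lerD// ?f_K// g_K.
Qed.

Let v_K : (\int[p]_z (v z)%:E <= (2 * K)%:E)%E.
Proof.
apply: integral_le_of_min => // [z|N].
  by rewrite addr_ge0// le_max lexx orbT.
apply: le_trans (b_K (ltr0Sn R N)); apply: le_bmfun_integral; last 2 first.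
- exact: (bb (ltr0Sn R N)).
- move=> z; rewrite /v /b /clamp.
  have : N%:R <= N.+1%:R :> R by rewrite ler_nat.
  have N0 : 0 <= N%:R :> R by rewrite ler0n.
  have : 0 <= Num.max (f z.1) 0 by rewrite le_max lexx orbT.
  have : 0 <= Num.max (g z.2) 0 by rewrite le_max lexx orbT.
  move: (Num.max (f z.1) 0) (Num.max (g z.2) 0) (N.+1%:R) => a d M a0 d0 NM.
  by apply: min_add_le => //; exact: le_trans NM.
split; first by apply: measurable_minr => //; exact: measurable_cst.
exists N%:R => z; rewrite ger0_norm ?ge_min ?lexx ?orbT// le_min ler0n andbT.
by rewrite addr_ge0// le_max lexx orbT.
Qed.

(** Since [c = f (+) g - u], [c] is at most the sum of the positive parts of [f] and [g] plus
    [exp (- u)]. The density of [p] is [exp u], so the last term has [p]-integral at most 1. *)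
Let c_K : (\int[p]_z (c z)%:E <= (2 * K + 1)%:E)%E.
Proof.
have [_ _ _ dp] := fgp.
apply: integral_le_of_min => // N.
pose M : R := N.+1%:R; have M0 : 0 < M by rewrite ltr0n.
pose w z := Num.min (expR (- u z)) M.
have bw : bmfun (w : (borel X * borel Y)%type -> R).
  split; last first.
    exists M => z; rewrite ger0_norm ?ge_min ?lexx ?orbT//.
    by rewrite le_min expR_ge0 ltW.
  apply: measurable_minr; last exact: measurable_cst.
  by apply: measurableT_comp => //; exact: measurable_funN.
have w1 : \int[p]_z w z <= 1.
  have [iw ->] := is_density_integral dp bw.
  rewrite -(prob_integral_cst (mu \x nu)%E 1); apply: le_Rintegral => //.
    apply: (@bmfun_integrable _ (borel X * borel Y)%type R (mu \x nu)%E (fun=> 1)).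
    exact: bmfun_cst.
  move=> z _; rewrite -/(u z) -(expRxMexpNx_1 (u z)) mulrC ler_wpM2l ?expR_ge0//.
  by rewrite ge_min lexx.
have bbw := bmfunD (bb M0) bw.
apply: (@le_trans _ _ (\int[p]_z (b z M + w z))); last first.
  by rewrite bmfun_integralD//; [exact: lerD (b_K M0) w1|exact: bb].
apply: le_bmfun_integral => //.
  split; first by apply: measurable_minr => //; exact: measurable_cst.
  exists N%:R => z; rewrite ger0_norm ?ge_min ?lexx ?orbT//.
  by rewrite le_min c0 ler0n.
move=> z; rewrite /b /w /clamp.
have NM : N%:R <= M by rewrite ler_nat.
have : 0 <= Num.max (f z.1) 0 by rewrite le_max lexx orbT.
have : 0 <= Num.max (g z.2) 0 by rewrite le_max lexx orbT.
have : f z.1 <= Num.max (f z.1) 0 by rewrite le_max lexx.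
have : g z.2 <= Num.max (g z.2) 0 by rewrite le_max lexx.
have := expR_ge0 (- u z); have := expR_ge1Dx (- u z); rewrite /u /oplus.
move: (Num.max (f z.1) 0) (Num.max (g z.2) 0) (expR _) => a d q *.
have cadq : c z <= a + d + q by lra.
apply: (@le_trans _ _ (Num.min (a + d + q) N%:R)).
  by rewrite le_min !ge_min cadq lexx orbT.
apply: le_trans (min_add_le _ _ (ltW M0) NM) _; [exact: addr_ge0|by []|].
by rewrite lerD2r min_add_le// ltW.
Qed.

(** As [c] is nonnegative, the positive part of the logarithm [u] of the density is at most [v]. *)
Let u_K : (\int[p]_z (u z)%:E < +oo)%E.
Proof.
apply: le_lt_trans (ltry (2 * K)); apply: le_trans v_K.
have meu : measurable_fun [set: (borel X * borel Y)%type] (EFin \o u).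
  exact/measurable_EFinP.
rewrite integralE (@le_trans _ _ (\int[p]_z ((EFin \o u)^\+)%E z)%E)//.
  by apply: geeDl; rewrite oppe_le0; apply: integral_ge0.
apply: ge0_le_integral => //.
- exact: measurable_funepos.
- exact/measurable_EFinP.
move=> z _; rewrite funeposE /= ge_max !lee_fin /u /v /oplus.
have := c0 z.
have := le_refl (Num.max (f z.1) 0); rewrite {1}ge_max => /andP[].
have := le_refl (Num.max (g z.2) 0); rewrite {1}ge_max => /andP[].
move: (Num.max (f z.1) 0) (Num.max (g z.2) 0) => a b' *.
by apply/andP; split; lra.
Qed.

Lemma gibbs_coupling_finite_cost : (transport_cost c mu nu p < +oo)%E.
Proof.
have [_ _ _ [mq pP dq]] := fgp.
rewrite /transport_cost lte_add_pinfty//; first exact: le_lt_trans c_K (ltry _).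
rewrite /relative_entropy asboolT//.
rewrite (@ae_eq_integral _ _ _ p setT (EFin \o u))//.
- exact: measurable_lne_density.
- exact/measurable_EFinP.
(* The density is known almost everywhere for the product; absolute continuity carries the null set
   over to [p], under which the entropy is integrated. *)
- move/null_content_dominatesP : pP => pP.
  have [A [mA A0 sA]] := dq; exists A; split => //; first exact: pP.
  move=> z /= nz; apply: sA => /= dz; apply: nz => _.
  by rewrite dz lne_EFin ?expR_gt0// expRK.
Qed.

End finite_cost.

Lemma clamp_integral_bounded d (T : measurableType d) (R : realType)
    (P_ : nat -> probability T R) (f_ : nat -> T -> R) :
  (forall n, measurable_fun setT (f_ n)) ->
  (ereal_sup (range (fun n => \int[P_ n]_x ((f_ n)^\+ x)%R%:E)) < +oo)%E ->
  exists K : R, forall n (M : R), 0 < M -> \int[P_ n]_x clamp M (f_ n x) <= K.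
Proof.
move=> mf; set S := ereal_sup _ => Soo.
have fS n : (\int[P_ n]_x ((f_ n)^\+ x)%R%:E <= S)%E.
  by apply: ereal_sup_ubound; exists n.
have S0 : (0 <= S)%E.
  apply: le_trans (fS 0%N); apply: integral_ge0 => x _.
  by rewrite lee_fin funrpos_ge0.
have Sfin : S \is a fin_num by rewrite ge0_fin_numE.
exists (fine S) => n M M0.
have bM := dist1_lipschitz_bmfun (clamp_lipschitz (ltW M0)).
have bc := bmfun_comp bM (mf n).
rewrite -lee_fin -bmfun_integralE// (fineK Sfin).
apply: le_trans (fS n); apply: ge0_le_integral => //.
- by move=> x _; rewrite lee_fin; have /andP[] := clamp_itv (f_ n x) (ltW M0).
- by apply/measurable_EFinP; have [] := bc.
- by apply/measurable_EFinP; exact: measurable_funrpos.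
- by move=> x _; rewrite lee_fin /funrpos /clamp ge_min lexx.
Qed.

(** * Almost sure statements and convergence on a product *)

Section product_probability.
Context d1 d2 (T1 : measurableType d1) (T2 : measurableType d2) (R : realType).
Variables (P : probability T1 R) (Q : probability T2 R).

Lemma product_prob_fst (A : set T1) : measurable A ->
  ((P \x Q) (fst @^-1` A) = P A)%E.
Proof.
move=> mA; rewrite -setXT product_measure1E//.
by rewrite [X in (_ * X)%E](probability_setT Q) mule1.
Qed.

Lemma product_prob_snd (A : set T2) : measurable A ->
  ((P \x Q) (snd @^-1` A) = Q A)%E.
Proof.
move=> mA; rewrite -setTX product_measure1E//.
by rewrite [X in (X * _)%E](probability_setT P) mul1e.
Qed.

(** The cylinder over the measurable set where [f] and [f'] differ lies in the null set, and its
    product measure is that of its base. *)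
Lemma ae_prod_fst (f f' : T1 -> R) :
  measurable_fun setT f -> measurable_fun setT f' ->
  {ae (P \x Q)%E, forall z, f z.1 = f' z.1} -> {ae P, forall x, f x = f' x}.
Proof.
move=> mf mf' [N [mN N0 sN]].
have mA := measurable_norm_gt 0 (measurable_funB mf mf').
exists [set x | 0 < `|f x - f' x|]; split => //; last first.
  by move=> x /= /eqP nx; rewrite normr_gt0 subr_eq0.
rewrite -[LHS](product_prob_fst mA); apply: subset_measure0 N0 => //.
  by rewrite -[X in measurable X]setTI; exact: measurable_fst.
by move=> z; rewrite /= normr_gt0 subr_eq0 => /eqP nz; exact: sN.
Qed.

Lemma ae_prod_snd (g g' : T2 -> R) :
  measurable_fun setT g -> measurable_fun setT g' ->
  {ae (P \x Q)%E, forall z, g z.2 = g' z.2} -> {ae Q, forall y, g y = g' y}.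
Proof.
move=> mg mg' [N [mN N0 sN]].
have mA := measurable_norm_gt 0 (measurable_funB mg mg').
exists [set y | 0 < `|g y - g' y|]; split => //; last first.
  by move=> y /= /eqP ny; rewrite normr_gt0 subr_eq0.
rewrite -[LHS](product_prob_snd mA); apply: subset_measure0 N0 => //.
  by rewrite -[X in measurable X]setTI; exact: measurable_snd.
by move=> z; rewrite /= normr_gt0 subr_eq0 => /eqP nz; exact: sN.
Qed.

Lemma cvg_prob_oplus (U : set_system nat) (f_ : nat -> T1 -> R) (f : T1 -> R)
    (g_ : nat -> T2 -> R) (g : T2 -> R) (e : R) : ProperFilter U ->
  (forall n, measurable_fun setT (f_ n)) -> measurable_fun setT f ->
  (forall n, measurable_fun setT (g_ n)) -> measurable_fun setT g ->
  (fun n => P [set x | e / 2 < `|f_ n x - f x|]) @ U --> 0%E ->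
  (fun n => Q [set y | e / 2 < `|g_ n y - g y|]) @ U --> 0%E ->
  (fun n => (P \x Q)%E [set z | e < `|oplus (f_ n) (g_ n) z - oplus f g z|])
    @ U --> 0%E.
Proof.
move=> PU mf_ mf mg_ mg Hf Hg.
have mA n := measurable_norm_gt (e / 2) (measurable_funB (mf_ n) mf).
have mB n := measurable_norm_gt (e / 2) (measurable_funB (mg_ n) mg).
have mC n := measurable_norm_gt e (measurable_funB
  (measurable_oplus (mf_ n) (mg_ n)) (measurable_oplus mf mg)).
apply: cvg_prob0 => // d d0; have d20 : 0 < d / 2 by rewrite divr_gt0.
apply: filterS2 (cvg_prob0P PU mA Hf d20) (cvg_prob0P PU mB Hg d20).
move=> n Hn1 Hn2.
rewrite -(product_prob_fst (mA n)) in Hn1.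
rewrite -(product_prob_snd (mB n)) in Hn2.
have mA' : measurable ((fst : T1 * T2 -> _) @^-1`
    [set x | e / 2 < `|(f_ n \- f) x|]).
  by rewrite -[X in measurable X]setTI; exact: measurable_fst.
have mB' : measurable ((snd : T1 * T2 -> _) @^-1`
    [set y | e / 2 < `|(g_ n \- g) y|]).
  by rewrite -[X in measurable X]setTI; exact: measurable_snd.
rewrite (_ : d%:E = (d / 2)%:E + (d / 2)%:E)%E; last by rewrite -EFinD -splitr.
apply: le_trans (leeD Hn1 Hn2); apply: le_trans (measureU2 _ mA' mB').
apply: (@le_measure _ _ _ (P \x Q)%E); rewrite ?inE.
- exact: (mC n).
- exact: measurableU.
move=> z; rewrite /oplus /= => ez.
have [H|H] := ltP (e / 2) `|f_ n z.1 - f z.1|; [by left|right].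
have := ler_normD (f_ n z.1 - f z.1) (g_ n z.2 - g z.2).
by rewrite addrACA -opprD; lra.
Qed.

End product_probability.

Lemma ae_imp d (T : measurableType d) (R : realType) (P : probability T R)
    (A B : T -> Prop) :
  {ae P, forall x, A x} -> (forall x, A x -> B x) -> {ae P, forall x, B x}.
Proof. by move=> PA AB; apply: filterS PA. Qed.

Lemma ae_imp2 d (T : measurableType d) (R : realType) (P : probability T R)
    (A B C : T -> Prop) : {ae P, forall x, A x} -> {ae P, forall x, B x} ->
  (forall x, A x -> B x -> C x) -> {ae P, forall x, C x}.
Proof. by move=> PA PB AB; apply: filterS2 PA PB. Qed.

Lemma ae_le_measure d (T : measurableType d) (R : realType)
    (P : probability T R) (A B : set T) : measurable A -> measurable B ->
  {ae P, forall x, A x -> B x} -> (P A <= P B)%E.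
Proof.
move=> mA mB [N [mN N0 sN]].
apply: (@le_trans _ _ (P (B `|` N))).
  apply: le_measure; rewrite ?inE//; first exact: measurableU.
  move=> x Ax; have [Bx|nBx] := pselect (B x); first by left.
  by right; apply: sN => /= /(_ Ax).
by apply: le_trans (measureU2 P mB mN) _; rewrite [X in (_ + X)%E]N0 adde0.
Qed.

Lemma cvg_prob_ae_eq d (T : measurableType d) (R : realType)
    (P : probability T R) (U : set_system nat) (f_ : nat -> T -> R)
    (f f' : T -> R) (e : R) : (forall n, measurable_fun setT (f_ n)) ->
  measurable_fun setT f -> measurable_fun setT f' ->
  {ae P, forall x, f x = f' x} ->
  (fun n => P [set x | e < `|f_ n x - f' x|]) @ U --> 0%E ->
  (fun n => P [set x | e < `|f_ n x - f x|]) @ U --> 0%E.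
Proof.
move=> mf_ mf mf' ff'.
rewrite (_ : (fun n => P [set x | e < `|f_ n x - f x|]) =
             (fun n => P [set x | e < `|f_ n x - f' x|]))//.
have mA n := measurable_norm_gt e (measurable_funB (mf_ n) mf).
have mB n := measurable_norm_gt e (measurable_funB (mf_ n) mf').
apply/funext => n; apply/eqP; rewrite eq_le; apply/andP; split.
  by apply: (ae_le_measure (mA n) (mB n)); apply: (ae_imp ff') => x /= ->.
by apply: (ae_le_measure (mB n) (mA n)); apply: (ae_imp ff') => x /= ->.
Qed.

(** * From potentials to Gibbs couplings, and normalization *)

Section potentials.
Context {R : realType} {X Y : ptopologicalType}.
Hypotheses (polishX : polish R X) (polishY : polish R Y).
Variable c : X * Y -> R.
Hypothesis cc : continuous c.
Variables (mu : probability (borel X) R) (nu : probability (borel Y) R).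

Lemma potentials_gibbs_coupling (f : X -> R) (g : Y -> R) :
  potentials c mu nu f g -> exists p, gibbs_coupling c mu nu f g p.
Proof.
move=> [mf mg [p [[_ cp _] pP dp]]]; exists p; split => //; split => //.
apply: measurableT_comp => //; apply: measurable_funB.
  exact: measurable_oplus.
exact: continuous_prod_measurable.
Qed.

(* If [f (+) g = f' (+) g'] a.e. then [atan f - atan f'] and [atan (g - g')]
   have opposite signs, while their product has integral [0]. *)
Lemma oplus_eq_of_atan (f f' : X -> R) (g g' : Y -> R) :
  measurable_fun [set: borel X] f -> measurable_fun [set: borel X] f' ->
  measurable_fun [set: borel Y] g -> measurable_fun [set: borel Y] g' ->
  {ae (mu \x nu)%E, forall z, oplus f g z = oplus f' g' z} ->
  \int[mu]_x atan (f x) = \int[mu]_x atan (f' x) ->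
  {ae (mu \x nu)%E, forall z, f z.1 = f' z.1 /\ g z.2 = g' z.2}.
Proof.
move=> mf mf' mg mg' fg intf.
have batan : bmfun (@atan R).
  split; last by exists trigo.pi => r; exact: atan_bounded.
  by apply: continuous_measurable_fun; exact: continuous_atan.
have bf := bmfun_comp batan mf; have bf' := bmfun_comp batan mf'.
have bh : bmfun (fun x : borel X => atan (f x) - atan (f' x)) by exact: bmfunB.
have bk : bmfun (fun y : borel Y => atan (g y - g' y)).
  by apply: bmfun_comp => //; exact: measurable_funB.
pose w (z : borel X * borel Y) : R :=
  (atan (f z.1) - atan (f' z.1)) * atan (g z.2 - g' z.2).
have bw : bmfun w.
  apply: bmfunM; [exact: (bmfun_fst (borel Y) bh)|exact: (bmfun_snd (borel X) bk)].
have w0 : \int[(mu \x nu)%E]_z w z = 0.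
  by rewrite (integral_prod_tensor mu nu bh bk) bmfun_integralB// intf subrr mul0r.
have wsign z : oplus f g z = oplus f' g' z ->
    w z <= 0 /\ (w z = 0 -> f z.1 = f' z.1 /\ g z.2 = g' z.2).
  rewrite /oplus /w => fgz; have -> : g z.2 - g' z.2 = - (f z.1 - f' z.1) by lra.
  rewrite atanN mulrN oppr_le0.
  have [ff|ff|ff] := ltgtP (f z.1) (f' z.1).
  - have h1 : atan (f z.1) - atan (f' z.1) < 0 by rewrite subr_lt0 lt_atan.
    have h2 : atan (f z.1 - f' z.1) < 0 by rewrite -[ltRHS]atan0 lt_atan// subr_lt0.
    split; first by rewrite mulr_le0// ltW.
    by move=> /eqP; rewrite oppr_eq0 mulf_eq0 !lt_eqF.
  - have h1 : 0 < atan (f z.1) - atan (f' z.1) by rewrite subr_gt0 lt_atan.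
    have h2 : 0 < atan (f z.1 - f' z.1) by rewrite -[ltLHS]atan0 lt_atan// subr_gt0.
    split; first by rewrite mulr_ge0// ltW.
    by move=> /eqP; rewrite oppr_eq0 mulf_eq0 !gt_eqF.
  - by rewrite ff !subrr mul0r; split => // _; split => //; lra.
have intw : (\int[(mu \x nu)%E]_z `|(w z)%:E| = 0)%E.
  transitivity (\int[(mu \x nu)%E]_z (- w z)%:E)%E.
    apply: ae_eq_integral => //.
    - by apply: measurableT_comp => //; apply/measurable_EFinP; have [] := bw.
    - by apply/measurable_EFinP; apply: measurable_funN; have [] := bw.
    - by apply: (ae_imp fg) => z /wsign[wz _] _ /=; rewrite ler0_norm.
  have bN : bmfun (fun z => -1 * w z) by apply: bmfunM => //; exact: bmfun_cst.
  under eq_integral do rewrite -mulN1r.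
  by rewrite bmfun_integralE// bmfun_integralZl// w0 mulr0.
have mw : measurable_fun setT (EFin \o w) by apply/measurable_EFinP; have [] := bw.
have [/(_ intw) + _] := ae_eq_integral_abs (mu \x nu)%E measurableT mw.
move=> w_eq0; apply: (ae_imp2 fg w_eq0).
by move=> z /wsign[_ wz] /(_ I)/= [] /wz.
Qed.

End potentials.

(** * Convergence of the potentials *)

Theorem corollary2p4 (R : realType) (X Y : ptopologicalType)
  (polishX : polish R X) (polishY : polish R Y)
  (c : X * Y -> R) (c_continuous : continuous c) (c_ge0 : forall z, 0 <= c z)
  (mu_ : nat -> probability (borel X) R) (nu_ : nat -> probability (borel Y) R)
  (f_ : nat -> X -> R) (g_ : nat -> Y -> R)
  (cost_fin : forall n, (eot_cost c (mu_ n) (nu_ n) < +oo)%E)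
  (pot_ : forall n, potentials c (mu_ n) (nu_ n) (f_ n) (g_ n))
  (f_bound : (ereal_sup
     (range (fun n => \int[mu_ n]_x ((f_ n)^\+ x)%R%:E)) < +oo)%E)
  (g_bound : (ereal_sup
     (range (fun n => \int[nu_ n]_y ((g_ n)^\+ y)%R%:E)) < +oo)%E)
  (mu : probability (borel X) R) (nu : probability (borel Y) R)
  (mu_cvg : weak_cvg mu_ mu) (nu_cvg : weak_cvg nu_ nu)
  (mu_dom : forall n, mu `<< mu_ n) (nu_dom : forall n, nu `<< nu_ n)
  (mu_tail : limf_esup (fun C : R => limn_esup (fun n =>
     mu [set x | (C%:E <= density mu (mu_ n) x)%E])) (pinfty_nbhs R) = 0%E)
  (nu_tail : limf_esup (fun C : R => limn_esup (fun n =>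
     nu [set y | (C%:E <= density nu (nu_ n) y)%E])) (pinfty_nbhs R) = 0%E) :
  [/\ (eot_cost c mu nu < +oo)%E,
      forall (f : X -> R) (g : Y -> R), potentials c mu nu f g ->
        cvg_in_probability (mu \x nu)%E
          (fun n => oplus (f_ n) (g_ n)) (oplus f g) &
      forall alpha : R,
        (fun n => \int[mu_ n]_x atan (f_ n x)) @ \oo --> alpha ->
        forall (f : X -> R) (g : Y -> R), potentials c mu nu f g ->
        \int[mu]_x atan (f x) = alpha ->
        cvg_in_probability mu f_ f /\ cvg_in_probability nu g_ g].
Proof.
have mf_ n : measurable_fun [set: borel X] (f_ n) by have [] := pot_ n.
have mg_ n : measurable_fun [set: borel Y] (g_ n) by have [] := pot_ n.
have [K1 f_K1] := clamp_integral_bounded mf_ f_bound.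
have [K2 g_K2] := clamp_integral_bounded mg_ g_bound.
pose K := Num.max K1 K2.
have f_K n (M : R) : 0 < M -> \int[mu_ n]_x clamp M (f_ n x) <= K.
  by move=> M0; rewrite (le_trans (f_K1 n M M0))// le_max lexx.
have g_K n (M : R) : 0 < M -> \int[nu_ n]_y clamp M (g_ n y) <= K.
  by move=> M0; rewrite (le_trans (g_K2 n M M0))// le_max lexx orbT.
have [p_ fgp_] := choice
  (fun n => potentials_gibbs_coupling polishX polishY c_continuous (pot_ n)).
have limit (U : set_system nat) : UltraFilter U -> \oo `<=` U ->
    exists f, exists g, exists p, [/\ gibbs_coupling c mu nu f g p,
      approx_limit U mu_ mu f_ f & approx_limit U nu_ nu g_ g].
  move=> UU ooU; have muU := weak_cvg_along ooU mu_cvg.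
  have nuU := weak_cvg_along ooU nu_cvg.
  have [f fP] := potential_limit_l polishX polishY c_continuous c_ge0 UU muU nuU
    fgp_ f_K g_K.
  have [g gP] := potential_limit_r polishX polishY c_continuous c_ge0 UU muU nuU
    fgp_ f_K g_K.
  have [p fgp] := limit_gibbs_coupling polishX polishY c_continuous c_ge0 UU muU nuU
    fgp_ f_K g_K fP gP.
  by exists f, g, p.
have mu_cont := contiguous_of_tail mu_dom mu_tail.
have nu_cont := contiguous_of_tail nu_dom nu_tail.
split.
(* One ultrafilter is enough here: its limit is a coupling of finite cost. *)
- have [U [UU ooU]] := @ultraFilterLemma _ \oo _.
  have [f [g [p [fgp fP gP]]]] := limit U UU ooU.
  have muU := weak_cvg_along ooU mu_cvg; have nuU := weak_cvg_along ooU nu_cvg.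
  have := gibbs_coupling_finite_cost
    (continuous_prod_measurable polishX polishY c_continuous) c_ge0 fgp
    (clamp_limit_l UU muU fgp_ f_K fP) (clamp_limit_r UU nuU fgp_ g_K gP).
  apply: le_lt_trans; apply: ereal_inf_lbound; exists p => //.
  by have [] := fgp.
- move=> f g /(potentials_gibbs_coupling polishX polishY c_continuous)[p fgp] e e0.
  (* The limits [f'] and [g'] may depend on [U], but their sum agrees almost everywhere with the
     prescribed [f (+) g], since both come from Gibbs couplings of the same marginals. *)
  apply: cvg_ultra => U UU ooU.
  have [f' [g' [p' [fgp' fP gP]]]] := limit U UU ooU.
  have [mf mg _ _] := fgp; have [mf' mg' _ _] := fgp'.
  have PU : ProperFilter U := @ultra_proper _ _ UU.
  have e20 : 0 < e / 2 by rewrite divr_gt0.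
  have Hf := approx_limit_prob PU ooU mf_ fP mu_cont e20.
  have Hg := approx_limit_prob PU ooU mg_ gP nu_cont e20.
  have := cvg_prob_oplus PU mf_ mf' mg_ mg' Hf Hg.
  apply: (@cvg_prob_ae_eq _ _ _ (mu \x nu)%E).
  + by move=> n; exact: measurable_oplus.
  + exact: measurable_oplus.
  + exact: measurable_oplus.
  + exact: gibbs_coupling_unique fgp fgp'.
- move=> alpha a_alpha f g.
  move=> /(potentials_gibbs_coupling polishX polishY c_continuous)[p fgp] falpha.
  have [mf mg _ _] := fgp.
  have key (U : set_system nat) : UltraFilter U -> \oo `<=` U ->
      exists f' g', [/\ approx_limit U mu_ mu f_ f', approx_limit U nu_ nu g_ g' &
        {ae (mu \x nu)%E, forall z, f z.1 = f' z.1 /\ g z.2 = g' z.2}].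
    move=> UU ooU; have [f' [g' [p' [fgp' fP gP]]]] := limit U UU ooU.
    exists f', g'; split => //.
    have [mf' mg' _ _] := fgp'; have PU : ProperFilter U := @ultra_proper _ _ UU.
    apply: oplus_eq_of_atan => //; first exact: gibbs_coupling_unique fgp fgp'.
    rewrite falpha.
    (* [atan] is bounded and Lipschitz, so its integrals pass to the limit along [U]; the
       normalization of [f'] is thus [alpha] as well, which fixes the additive constant. The
       [eq_ind_r] term inserts the Lipschitz constant 1. *)
    have atanL := dist1_lipschitzP (@atan_bounded R)
      (fun r s => eq_ind_r (fun t => _ <= t) (atan_lipschitz r s) (mul1r _)).
    have := approx_limit_integral PU (weak_cvg_along ooU mu_cvg) mf_ fP
      (cbfun_cst 1) atanL.
    under eq_fun do under eq_Rintegral do rewrite mul1r.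
    under eq_Rintegral do rewrite mul1r.
    have aU : (fun n => \int[mu_ n]_x atan (f_ n x)) @ U --> alpha.
      by move=> A /a_alpha; exact: ooU.
    by move=> H; apply: (cvg_unique _ aU H).
  split=> e e0; apply: cvg_ultra => U UU ooU;
    have PU : ProperFilter U := @ultra_proper _ _ UU;
    have [f' [g' [fP gP eqfg]]] := key U UU ooU.
  + apply: cvg_prob_ae_eq (approx_limit_prob PU ooU mf_ fP mu_cont e0) => //.
      exact: fP.1.
    apply: (@ae_prod_fst _ _ _ (borel Y) _ _ nu) => //; first exact: fP.1.
    by apply: (ae_imp eqfg) => z [].
  + apply: cvg_prob_ae_eq (approx_limit_prob PU ooU mg_ gP nu_cont e0) => //.
      exact: gP.1.
    apply: (@ae_prod_snd _ _ (borel X) _ _ mu) => //; first exact: gP.1.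
    by apply: (ae_imp eqfg) => z [].
Qed.
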